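(* Let $G$ be a right-angled Artin group whose defining graph $\Gamma$ is connected, triangle-free, and has no vertices of valence $<2$. Let $\mathcal{P}$ be the collection of maximal standard abelian subgroups of $G$. Then the coset intersection complex $\mathcal{K}(G,\mathcal{P})$ is quasi-isometric to the extension graph $E(\Gamma)$ and to the contact graph $\mathcal{C}(\Gamma)$.
   Context: The defining graph $\Gamma$ is a finite simplicial graph; the right-angled Artin group $G$ has the vertices of $\Gamma$ as standard generators, with two generators commuting as a defining relation exactly when they are adjacent in $\Gamma$. A standard subgroup is a subgroup generated by a set of standard generators. Under the stated hypotheses the maximal standard abelian subgroups are exactly the subgroups $\langle a,b\rangle\cong\mathbb{Z}^2$ with $\{a,b\}$ an edge of $\Gamma$. $G/\mathcal{P}$ denotes the set of all left cosets $gP$ with $g\in G$, $P\in\mathcal{P}$. The coset intersection complex $\mathcal{K}(G,\mathcal{P})$ is the simplicial complex with vertex set $G/\mathcal{P}$ in which a finite set $\{g_1P_1,\dots,g_kP_k\}\subset G/\mathcal{P}$ spans a simplex if and only if $\bigcap_{i=1}^k g_iP_ig_i^{-1}$ is infinite. It carries the length metric of a piecewise Euclidean complex all of whose simplices are regular Euclidean simplices with unit edge lengths (the distance between points in different components is $\infty$). The extension graph $E(\Gamma)$ has vertex set $\{v^g : v\in V(\Gamma), g\in G\}$, where $v^g=gvg^{-1}$ (as elements of $G$), two distinct vertices $u^g$ and $v^h$ being adjacent if and only if they commute in $G$. The contact graph $\mathcal{C}(\Gamma)$: let $X(\Gamma)$ be the universal cover of the Salvetti complex of $G$ (a CAT(0)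 cube complex). The vertices of $\mathcal{C}(\Gamma)$ are the hyperplanes of $X(\Gamma)$, and two distinct vertices are adjacent if the carriers of the corresponding hyperplanes intersect, where the carrier of a hyperplane is the union of the closed cubes it meets. Graphs are equipped with the path metric with edges of length one. *)

(* Defs.v *)
From Stdlib Require Import Relation_Operators.
From HB Require Import structures.
From mathcomp Require Import all_boot all_order all_algebra.
From mathcomp Require Import all_classical all_reals ereal.

Set Implicit Arguments.
Unset Strict Implicit.
Unset Printing Implicit Defensive.

Import Order.TTheory GRing.Theory Num.Theory.
Local Open Scope classical_set_scope.
Local Open Scope ring_scope.
Local Open Scope quotient_scope.

(* A finite simplicial graph is a symmetric irreflexive relation [e] on a
   finite type. A connected graph is nonempty by convention. *)
Definition connected_graph (T : finType) (e : rel T) : Prop :=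
  (0 < #|T|)%N /\ forall u v : T, connect e u v.

Definition triangle_free (T : finType) (e : rel T) : Prop :=
  forall u v w : T, ~ [/\ e u v, e v w & e u w].

Definition valence (T : finType) (e : rel T) (v : T) : nat := #|[pred u | e v u]|.

Definition clique (T : finType) (e : rel T) (s : {set T}) : bool :=
  [forall u in s, forall v in s, (u != v) ==> e u v].

(* The letter (a, true) stands for the generator a, and (a, false) for its
   inverse. *)
Definition word (T : finType) := seq (T * bool).

Inductive word_eq (T : finType) (e : rel T) : word T -> word T -> Prop :=
| word_eq_refl u : word_eq e u u
| word_eq_sym u v : word_eq e u v -> word_eq e v u
| word_eq_trans u v w : word_eq e u v -> word_eq e v w -> word_eq e u w
| word_eq_cancel u v a b :
    word_eq e (u ++ [:: (a, b); (a, ~~ b)] ++ v) (u ++ v)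
| word_eq_comm u v a b : e a b ->
    word_eq e (u ++ [:: (a, true); (b, true)] ++ v)
              (u ++ [:: (b, true); (a, true)] ++ v).

Definition word_eqb (T : finType) (e : rel T) : rel (word T) :=
  fun u v => `[< word_eq e u v >].

Definition word_inv (T : finType) (u : word T) : word T :=
  rev [seq (x.1, ~~ x.2) | x <- u].

Section Raag.
Variables (T : finType) (e : rel T).
Implicit Types u v w : word T.

Lemma word_eqb_refl : reflexive (word_eqb e).
Proof. by move=> u; apply/asboolP; exact: word_eq_refl. Qed.

Lemma word_eqb_sym : symmetric (word_eqb e).
Proof.
by move=> u v; apply/asboolP/asboolP; exact: word_eq_sym.
Qed.

Lemma word_eqb_trans : transitive (word_eqb e).
Proof.
move=> v u w /asboolP uv /asboolP vw; apply/asboolP.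
exact: word_eq_trans uv vw.
Qed.

Canonical word_equiv : equiv_rel (word T) :=
  EquivRel (word_eqb e) word_eqb_refl word_eqb_sym word_eqb_trans.

Definition raag : Type := {eq_quot word_equiv}.
HB.instance Definition _ := Choice.on raag.
HB.instance Definition _ := EqQuotient.on raag.

Lemma raagP u v : \pi_raag u = \pi_raag v <-> word_eq e u v.
Proof. by split=> [/eqmodP/asboolP//|uv]; apply/eqmodP/asboolP. Qed.

Lemma word_eq_ctx w1 w2 u v :
  word_eq e u v -> word_eq e (w1 ++ u ++ w2) (w1 ++ v ++ w2).
Proof.
elim=> {u v} [u|u v _|u v w _ uv _|u v a b|u v a b ab].
- exact: word_eq_refl.
- exact: word_eq_sym.
- exact: word_eq_trans.
- by rewrite -!catA !(catA w1); exact: word_eq_cancel.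
- by rewrite -!catA !(catA w1); exact: word_eq_comm.
Qed.

Lemma word_eq_cat u u' v v' :
  word_eq e u u' -> word_eq e v v' -> word_eq e (u ++ v) (u' ++ v').
Proof.
move=> uu' vv'; apply: (@word_eq_trans _ _ _ (u' ++ v)).
  by have := word_eq_ctx [::] v uu'.
by have := word_eq_ctx u' [::] vv'; rewrite !cats0.
Qed.

Lemma word_eq_mulV u : word_eq e (u ++ word_inv u) [::].
Proof.
elim: u => [|[a b] u IH]; first exact: word_eq_refl.
have -> : ((a, b) :: u) ++ word_inv ((a, b) :: u) =
    [:: (a, b)] ++ (u ++ word_inv u) ++ [:: (a, ~~ b)].
  by rewrite /word_inv /= rev_cons -cats1 catA.
apply: word_eq_trans (word_eq_ctx [:: (a, b)] [:: (a, ~~ b)] IH) _.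
exact: (word_eq_cancel e [::] [::]).
Qed.

Lemma word_invK : involutive (@word_inv T).
Proof.
move=> u; rewrite /word_inv map_rev revK -map_comp -[RHS]map_id.
by apply: eq_map => -[a b] /=; rewrite negbK.
Qed.

Lemma word_eq_Vmul u : word_eq e (word_inv u ++ u) [::].
Proof. by rewrite -{2}(word_invK u); exact: word_eq_mulV. Qed.

Definition raag_one : raag := \pi_raag [::].
Definition raag_mul (x y : raag) : raag := \pi_raag (repr x ++ repr y).
Definition raag_inv (x : raag) : raag := \pi_raag (word_inv (repr x)).

Lemma raag_mulE u v : raag_mul (\pi_raag u) (\pi_raag v) = \pi_raag (u ++ v).
Proof.
rewrite /raag_mul; apply: (proj2 (raagP _ _)).
by apply: word_eq_cat; apply: (proj1 (raagP _ _)); rewrite reprK.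
Qed.

Lemma raag_mulA : associative raag_mul.
Proof.
move=> x y z; rewrite -[x]reprK -[y]reprK -[z]reprK.
rewrite (raag_mulE (repr y) (repr z)) (raag_mulE (repr x) (repr y)).
by rewrite (raag_mulE (repr x)) (raag_mulE _ (repr z)) catA.
Qed.

Lemma raag_mul1 : left_id raag_one raag_mul.
Proof. by move=> x; rewrite -[x]reprK raag_mulE. Qed.

Lemma raag_mulr1 : right_id raag_one raag_mul.
Proof. by move=> x; rewrite -[x]reprK raag_mulE cats0. Qed.

Lemma raag_mulV : left_inverse raag_one raag_inv raag_mul.
Proof.
move=> x; rewrite -{2}[x]reprK raag_mulE.
by apply: (proj2 (raagP _ _)); exact: word_eq_Vmul.
Qed.

Lemma raag_mulrV : right_inverse raag_one raag_inv raag_mul.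
Proof.
move=> x; rewrite -{1}[x]reprK raag_mulE.
by apply: (proj2 (raagP _ _)); exact: word_eq_mulV.
Qed.

HB.instance Definition _ := isGroup.Build raag
  raag_mulA raag_mul1 raag_mulr1 raag_mulV raag_mulrV.

Definition raag_gen (a : T) : raag := \pi_raag [:: (a, true)].

End Raag.

Definition is_subgroup (G : groupType) (H : set G) : Prop :=
  H 1%g /\ forall x y : G, H x -> H y -> H (x * y^-1)%g.

Definition is_abelian (G : groupType) (H : set G) : Prop :=
  forall x y : G, H x -> H y -> commute x y.

Definition left_coset (G : groupType) (g : G) (P : set G) : set G :=
  [set (g * x)%g | x in P].

(* g P g^-1; the library's [x ^ g] is g^-1 x g. *)
Definition conj_set (G : groupType) (g : G) (P : set G) : set G :=
  [set (g * x * g^-1)%g | x in P].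

Definition standard_subgroup (T : finType) (e : rel T) (A : set T) :
  set (raag e) := smallest (@is_subgroup (raag e)) [set raag_gen e a | a in A].
Arguments standard_subgroup {T} e A.

Definition standard_abelian (T : finType) (e : rel T) : set (set (raag e)) :=
  [set P | (exists A : set T, P = standard_subgroup e A) /\ is_abelian P].

Arguments standard_abelian {T} e.

Definition max_standard_abelian (T : finType) (e : rel T) :
  set (set (raag e)) :=
  [set P | standard_abelian e P /\
    forall Q : set (raag e), standard_abelian e Q -> P `<=` Q -> Q = P].
Arguments max_standard_abelian {T} e.

(* A complex is given by its set of simplices, each being the finite nonempty
   set of its vertices; the vertices are the [v] such that [set v] is a
   simplex, and need not exhaust [U]. *)
Record scomplex (U : Type) := SComplex {
  simplex :> set (set U);
  simplex_finite : forall S, simplex S -> finite_set S;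
  simplex_nonempty : forall S, simplex S -> S !=set0;
  simplex_face : forall S S' : set U,
    simplex S -> S' !=set0 -> S' `<=` S -> simplex S' }.

Section Realization.
Variables (R : realType) (U : choiceType) (K : scomplex U).

(* Points are given by barycentric coordinates. *)
Definition fsupport (x : U -> R) : set U := [set v | x v != 0].

Record realization := RPoint {
  bary :> U -> R;
  bary_ge0 : forall v, 0 <= bary v;
  bary_simplex : simplex K (fsupport bary);
  bary_sum : \sum_(v \in [set: U]) bary v = 1 }.

Definition common_simplex (x y : realization) : Prop :=
  exists S, [/\ simplex K S, fsupport x `<=` S & fsupport y `<=` S].

(* The distance inside a regular Euclidean simplex with unit edges: such a
   simplex has vertices (1 / sqrt 2) e_v in Euclidean space. *)
Definition simplex_dist (x y : realization) : R :=
  Num.sqrt ((\sum_(v \in [set: U]) (x v - y v) ^+ 2) / 2).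

(* A string is a finite sequence of points in which any two consecutive points
   lie in a common closed simplex. *)
Fixpoint is_string (x : realization) (s : seq realization) : Prop :=
  if s is y :: s' then common_simplex x y /\ is_string y s' else True.

Fixpoint string_length (x : realization) (s : seq realization) : R :=
  if s is y :: s' then simplex_dist x y + string_length y s' else 0.

(* The length (pseudo)metric of a piecewise Euclidean complex; it is +oo
   between points that no string connects. *)
Definition length_dist (x y : realization) : \bar R :=
  ereal_inf [set (string_length x s)%:E |
    s in [set s | is_string x s /\ last x s = y]].

End Realization.

Arguments length_dist {R U} K.

Definition quasi_isometric (R : realType) (X Y : Type)
    (dX : X -> X -> \bar R) (dY : Y -> Y -> \bar R) : Prop :=
  exists (f : X -> Y) (L C : R),
    [/\ 1 <= L, 0 <= C,
      forall x x' : X,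
        ((L^-1)%:E * dX x x' - C%:E <= dY (f x) (f x'))%E /\
        (dY (f x) (f x') <= L%:E * dX x x' + C%:E)%E
      & forall y : Y, exists x : X, (dY (f x) y <= C%:E)%E].

Definition complex_quasi_isometric (R : realType) (U U' : choiceType)
    (K : scomplex U) (K' : scomplex U') : Prop :=
  quasi_isometric (X := realization R K) (Y := realization R K')
    (length_dist K) (length_dist K').

Section GraphComplex.
Variables (U : Type) (V : set U) (E : U -> U -> Prop).

(* The realization of this complex with its length metric is the graph with
   edges of length one and the path metric. *)
Definition graph_simplex : set (set U) :=
  [set S | (exists2 v, V v & S = [set v]) \/
           (exists u v, [/\ V u, V v, u <> v, E u v & S = [set u; v]])].

Lemma graph_simplex_finite S : graph_simplex S -> finite_set S.
Proof.
case=> [[v _ ->]|[u [v [_ _ _ _ ->]]]]; first exact: finite_set1.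
by rewrite finite_setU; split; exact: finite_set1.
Qed.

Lemma graph_simplex_nonempty S : graph_simplex S -> S !=set0.
Proof.
by case=> [[v _ ->]|[u [v [_ _ _ _ ->]]]]; [exists v | exists u; left].
Qed.

Lemma graph_simplex_face S S' :
  graph_simplex S -> S' !=set0 -> S' `<=` S -> graph_simplex S'.
Proof.
case=> [[v Vv ->]|[u [v [Vu Vv uv Euv ->]]]] S'0 S'S.
  left; exists v => //; apply/seteqP; split => // _ ->.
  by case: S'0 => w S'w; rewrite -(S'S _ S'w).
have [S'u|S'u] := pselect (S' u); have [S'v|S'v] := pselect (S' v).
- right; exists u, v; split => //; apply/seteqP; split => // _ [|] -> //.
- left; exists u => //; apply/seteqP; split => [w S'w|_ -> //].
  by have [//|wv] := S'S _ S'w; rewrite wv in S'w.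
- left; exists v => //; apply/seteqP; split => [w S'w|_ -> //].
  by have [wu|//] := S'S _ S'w; rewrite wu in S'w.
- by case: S'0 => w S'w; have [wu|wv] := S'S _ S'w;
  [rewrite wu in S'w | rewrite wv in S'w].
Qed.

Definition graph_complex : scomplex U :=
  SComplex graph_simplex_finite graph_simplex_nonempty graph_simplex_face.

End GraphComplex.

Section CosetIntersection.
Variables (G : groupType) (P : set (set G)).

Definition cosets : set (set G) :=
  [set C | exists g Q, P Q /\ C = left_coset g Q].

(* The intersection of the conjugates g Q g^-1 for g Q in S; the conjugate
   g Q g^-1 depends only on the coset g Q. *)
Definition coset_conj_inter (S : set (set G)) : set G :=
  [set x | forall g Q, P Q -> S (left_coset g Q) -> conj_set g Q x].

Definition coset_simplex : set (set (set G)) :=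
  [set S | [/\ finite_set S, S !=set0, S `<=` cosets &
              infinite_set (coset_conj_inter S)]].

Lemma coset_simplex_finite S : coset_simplex S -> finite_set S.
Proof. by case. Qed.

Lemma coset_simplex_nonempty S : coset_simplex S -> S !=set0.
Proof. by case. Qed.

Lemma coset_simplex_face S S' :
  coset_simplex S -> S' !=set0 -> S' `<=` S -> coset_simplex S'.
Proof.
move=> [finS _ SP infS] S'0 S'S; split => //.
- exact: sub_finite_set finS.
- exact: subset_trans SP.
- apply: contra_not infS; apply: sub_finite_set => x xS g Q PQ S'gQ.
  by apply: xS => //; exact: S'S.
Qed.

Definition coset_intersection_complex : scomplex (set G) :=
  SComplex coset_simplex_finite coset_simplex_nonempty coset_simplex_face.

End CosetIntersection.

Definition extension_vertex (T : finType) (e : rel T) : set (raag e) :=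
  [set x | exists (v : T) (g : raag e), x = (g * raag_gen e v * g^-1)%g].
Arguments extension_vertex {T} e.

Definition extension_graph (T : finType) (e : rel T) : scomplex (raag e) :=
  graph_complex (extension_vertex e) (fun x y => commute x y).

(* The Salvetti complex has one vertex, one oriented loop per vertex of the
   defining graph and one k-torus per k-clique. Its edge paths are the words,
   and [word_eq] is edge-path homotopy, so its fundamental group is [raag e].
   A cell of the universal cover is a lift of the cell of a clique, and is
   determined by the clique and by its initial corner, which is a homotopy
   class of edge paths, that is, an element of the group. *)
Section Contact.
Variables (T : finType) (e : rel T).

Record cube := Cube {
  corner : raag e;
  dirs : {set T};
  dirs_clique : clique e dirs }.

(* The two codimension-one faces of the cube [d] orthogonal to the direction
   [v] start at [corner d] and at the other end of the edge of [d] labelled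
   [v] at [corner d]. *)
Definition facet (c d : cube) : Prop :=
  exists v, [/\ v \in dirs d, dirs c = (dirs d :\ v)%SET &
    corner c = corner d \/ corner c = (corner d * raag_gen e v)%g].

(* The set of the faces of a cube, which represents the closed cube. *)
Definition closed_cube (d : cube) : set cube :=
  [set c | clos_refl_trans cube facet c d].

(* The midcube of [mcube] orthogonal to the direction [mdir]. *)
Record midcube := Midcube {
  mcube : cube;
  mdir : T;
  mdir_in : mdir \in dirs mcube }.

Definition midcube_facet (m n : midcube) : Prop :=
  facet (mcube m) (mcube n) /\ mdir m = mdir n.

(* A hyperplane is a class of midcubes for the equivalence relation generated
   by being a face, that is, a connected union of midcubes. *)
Definition hyperplane : set (set midcube) :=
  [set H | exists m, H = [set n | clos_refl_sym_trans midcube midcube_facet m n]].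

Definition carrier (H : set midcube) : set cube :=
  \bigcup_(m in H) closed_cube (mcube m).

(* Carriers are subcomplexes, so they intersect exactly when they have a cube
   in common. *)
Definition contact_graph : scomplex (set midcube) :=
  graph_complex hyperplane (fun H H' => carrier H `&` carrier H' !=set0).

End Contact.

(* Main.v *)
(* In each of the three complexes, two simplices that share two vertices lie in a
   common simplex. Although the coset intersection complex is infinite
   dimensional, this forces paths between different maximal simplices through
   vertices, so the length metric is comparable to the combinatorial distance of
   the 1-skeleton. It then suffices to compare 1-skeletons, by relations between
   vertices: the coset g<a, b> is related to the vertices g a g^-1 and g b g^-1 of
   the extension graph, and to the hyperplanes dual to the edges labelled a and b
   of the corresponding flat of the cube complex.
   The group theory reduces to the centralizer of an element x of the subgroup
   generated by the star of a, with nonzero exponent sum in a: it is contained in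
   that subgroup. With retractions onto standard subgroups, this shows that
   cosets adjacent in the coset intersection complex have the form g<v, p> and
   g s<v, q> with s in the subgroup generated by the link of v, and that commuting
   vertices of the extension graph are simultaneously conjugate to standard
   generators. *)
Require Import Defs.
From Stdlib Require Import Relation_Operators.
From HB Require Import structures.
From mathcomp Require Import all_boot all_order all_algebra finmap.
From mathcomp Require Import all_classical all_reals ereal.
From mathcomp Require Import zify ring lra.

Set Implicit Arguments.
Unset Strict Implicit.
Unset Printing Implicit Defensive.

Import Order.TTheory GRing.Theory Num.Theory.
Local Open Scope classical_set_scope.
Local Open Scope ring_scope.
Local Open Scope quotient_scope.

(** * Complexes whose simplices are glued along single vertices *)

Section LeastIndex.
Variable P : nat -> Prop.

(* Junk value [0] when [P] is empty. *)
Definition least : nat :=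
  if pselect (exists n, `[< P n >]) is left ex then ex_minn ex else 0%N.

Lemma leastP n : P n -> P least /\ (least <= n)%N.
Proof.
move=> Pn; rewrite /least; case: pselect => [ex|[]]; last by exists n; apply/asboolP.
by case: ex_minnP => m /asboolP Pm min; split => //; apply/min/asboolP.
Qed.

End LeastIndex.

(** * Combinatorial distance in the 1-skeleton *)

Section Reach.
Variables (U : choiceType) (K : scomplex U).
Implicit Types (S : set U) (u v w : U).

(** A vertex is adjacent to itself, since [[set u; u]] is [[set u]]; between vertices, [reach n]
    therefore means distance at most [n], not exactly [n]. *)
Definition adjacent u v : Prop := simplex K [set u; v].

Fixpoint reach n u v : Prop :=
  if n is n'.+1 then exists2 w, reach n' u w & adjacent w v else u = v.

(** As in a linear hypergraph, different maximal simplices can share at most one vertex. Graphs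
    satisfy this trivially. *)
Definition linear_complex : Prop := forall S S' u v,
  simplex K S -> simplex K S' -> u <> v ->
  S u -> S v -> S' u -> S' v -> simplex K (S `|` S').

Lemma simplex_sub S S' u : simplex K S -> S' u -> S' `<=` S -> simplex K S'.
Proof. by move=> KS S'u; apply: simplex_face => //; exists u. Qed.

Lemma simplex_adjacent S u v : simplex K S -> S u -> S v -> adjacent u v.
Proof. by move=> KS Su Sv; apply: (simplex_sub (u := u) KS) => [|_ [] ->]; first left. Qed.

Lemma simplex_vertex S u : simplex K S -> S u -> simplex K [set u].
Proof. by move=> KS Su; apply: (simplex_sub (u := u) KS) => // _ ->. Qed.

Lemma adjacent_refl u : simplex K [set u] -> adjacent u u.
Proof. by move=> Ku; exact: simplex_adjacent Ku _ _. Qed.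

Lemma adjacent_sym u v : adjacent u v -> adjacent v u.
Proof. by rewrite /adjacent setUC. Qed.

Lemma adjacent_vertex u v : adjacent u v -> simplex K [set v].
Proof. by move=> uv; apply: simplex_vertex uv _; right. Qed.

Lemma reach1 u v : adjacent u v -> reach 1 u v.
Proof. by move=> uv; exists u. Qed.

Lemma reach_cat m n u v w : reach m u v -> reach n v w -> reach (m + n) u w.
Proof.
move=> uv; elim: n w => [w <-|n IH w [x vx xw]]; first by rewrite addn0.
by rewrite addnS; exists x => //; exact: IH.
Qed.

Lemma reach_widen m n u v : simplex K [set v] -> (m <= n)%N ->
  reach m u v -> reach n u v.
Proof.
move=> Kv /subnKC <- uv; apply: (reach_cat uv).
elim: (n - m)%N => [//|k IH]; exists v => //; exact: adjacent_refl.
Qed.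

Lemma reach_vertex n u v : simplex K [set u] -> reach n u v -> simplex K [set v].
Proof. by case: n => [|n] Ku /= => [<- //|[w _ /adjacent_vertex]]. Qed.

End Reach.

(** * Length metric and combinatorial distance *)

Section LengthBounds.
Variables (R : realType) (U : choiceType) (K : scomplex U).
Implicit Types (S : set U) (u v w : U) (x y : realization R K).

Lemma fsum_simplex S (f : U -> R) : simplex K S -> (forall v, ~ S v -> f v = 0) ->
  \sum_(v \in [set: U]) f v = \sum_(v <- fset_set S) f v.
Proof.
move=> KS f0; have Sfin := simplex_finite KS.
by apply: fsbigTE => v; rewrite in_fset_set // => /negP Sv; apply: f0 => /mem_set.
Qed.

Lemma bary0 x S v : fsupport x `<=` S -> ~ S v -> x v = 0.
Proof.
by move=> xS Sv; apply/eqP/negPn/negP => xv; apply: Sv; exact: xS.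
Qed.

Lemma bary_sum_simplex x S : simplex K S -> fsupport x `<=` S ->
  \sum_(v <- fset_set S) x v = 1.
Proof. by move=> KS xS; rewrite -fsum_simplex ?bary_sum // => v; exact: bary0. Qed.

Lemma bary_le1 x v : x v <= 1.
Proof.
have [xv|xv] := pselect (fsupport x v); last by rewrite (bary0 (x := x) _ xv).
have Kx := bary_simplex x.
rewrite -(bary_sum_simplex (x := x) Kx) // (big_rem v) /=; last first.
  by rewrite in_fset_set ?inE //; exact: simplex_finite Kx.
by rewrite lerDl sumr_ge0 // => w _; exact: bary_ge0.
Qed.

Lemma bary_sqr_le x v : x v ^+ 2 <= x v.
Proof. by rewrite expr2 ler_piMl ?bary_ge0 ?bary_le1. Qed.

Lemma sum_sqr_le1 x S : simplex K S -> fsupport x `<=` S ->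
  \sum_(v <- fset_set S) x v ^+ 2 <= 1.
Proof.
move=> KS xS; rewrite -(bary_sum_simplex KS xS).
by apply: ler_sum => v _; exact: bary_sqr_le.
Qed.

Lemma simplex_distE x y S : simplex K S -> fsupport x `<=` S -> fsupport y `<=` S ->
  simplex_dist x y = Num.sqrt ((\sum_(v <- fset_set S) (x v - y v) ^+ 2) / 2).
Proof.
move=> KS xS yS; rewrite /simplex_dist (fsum_simplex KS) // => v Sv.
by rewrite (bary0 xS Sv) (bary0 yS Sv) subrr expr0n.
Qed.

Lemma simplex_dist_ge0 x y : 0 <= simplex_dist x y.
Proof. exact: sqrtr_ge0. Qed.

(** Coordinates are nonnegative, so [(x v - y v) ^+ 2 <= x v ^+ 2 + y v ^+ 2], and both sums of
    squares are at most 1 in any dimension. *)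
Lemma simplex_dist_le1 x y : common_simplex x y -> simplex_dist x y <= 1.
Proof.
move=> [S [KS xS yS]]; rewrite (simplex_distE KS xS yS) -[leRHS]sqrtr1 ler_wsqrtr //.
rewrite ler_pdivrMr ?ltr0n // mul1r.
apply: (@le_trans _ _ (\sum_(v <- fset_set S) (x v ^+ 2 + y v ^+ 2))).
  by apply: ler_sum => v _; have := bary_ge0 x v; have := bary_ge0 y v; nra.
rewrite big_split /=; have := sum_sqr_le1 KS xS; have := sum_sqr_le1 KS yS; lra.
Qed.

Lemma string_length_ge0 s x : 0 <= string_length x s.
Proof. by elim: s x => [//|y s IH] x /=; rewrite addr_ge0 // simplex_dist_ge0. Qed.

Lemma length_dist_string x y s : is_string x s -> last x s = y ->
  (length_dist K x y <= (string_length x s)%:E)%E.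
Proof. by move=> xs sy; apply: ereal_inf_lbound; exists s. Qed.

Section VertexPoint.
Variables (v : U) (Kv : simplex K [set v]).

Let delta (u : U) : R := (u == v)%:R.

Let delta_ge0 u : 0 <= delta u. Proof. exact: ler0n. Qed.

Let fsupport_delta : fsupport delta = [set v].
Proof.
apply/seteqP; split => [u|_ ->]; rewrite /fsupport /= /delta ?eqxx ?oner_eq0 //.
by rewrite pnatr_eq0 eqb0 negbK => /eqP.
Qed.

Let delta_simplex : simplex K (fsupport delta). Proof. by rewrite fsupport_delta. Qed.

Let delta_sum : \sum_(u \in [set: U]) delta u = 1.
Proof.
rewrite (fsum_simplex Kv) ?fset_set1 ?big_seq_fset1 /delta ?eqxx //.
by move=> u /eqP/negbTE ->.
Qed.

Definition vertex_point : realization R K := RPoint delta_ge0 delta_simplex delta_sum.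

Lemma fsupport_vertex_point : fsupport vertex_point = [set v].
Proof. exact: fsupport_delta. Qed.

End VertexPoint.

Lemma fsupport_neq0 x : exists v, fsupport x v.
Proof. exact: simplex_nonempty (bary_simplex x). Qed.

Lemma support_vertex x v : fsupport x v -> simplex K [set v].
Proof. exact: simplex_vertex (bary_simplex x). Qed.

Lemma adjacent_common_simplex u v (Ku : simplex K [set u]) (Kv : simplex K [set v]) :
  adjacent K u v -> common_simplex (vertex_point Ku) (vertex_point Kv).
Proof.
move=> uv; exists [set u; v]; split => //; rewrite fsupport_vertex_point => _ ->.
  by left.
by right.
Qed.

Lemma support_common_simplex x v (Kv : simplex K [set v]) :
  fsupport x v -> common_simplex x (vertex_point Kv).
Proof.
move=> xv; exists (fsupport x); split => //; first exact: bary_simplex.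
by rewrite fsupport_vertex_point => _ ->.
Qed.

Lemma common_simplex_sym x y : common_simplex x y -> common_simplex y x.
Proof. by case=> S [KS xS yS]; exists S. Qed.

(** The string follows the vertices of the path: [n] edges and two end pieces, each of length at
    most 1. *)
Lemma string_reach n u v (Ku : simplex K [set u]) (Kv : simplex K [set v]) x y :
  reach K n u v -> common_simplex x (vertex_point Ku) -> common_simplex (vertex_point Kv) y ->
  exists s, [/\ is_string x s, last x s = y & string_length x s <= n%:R + 2].
Proof.
elim: n v Kv y => [|n IH] v Kv y /=.
  move=> uv; rewrite -{}uv in Kv *; rewrite (Prop_irrelevance Kv Ku) => xu uy.
  exists [:: vertex_point Ku; y]; split => //=.
  have := simplex_dist_le1 xu; have := simplex_dist_le1 uy; lra.
move=> [w uw wv] xu vy; have Kw := adjacent_vertex (adjacent_sym wv).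
have [s [xs sv sn]] := IH w Kw _ uw xu (adjacent_common_simplex Kw Kv wv).
exists (rcons s y); rewrite last_rcons; split => //.
  rewrite -sv in vy.
  elim: s (x) xs vy {xu sn sv} => [|z s IHs] t //= [tz zs] zy; split => //.
  exact: IHs.
suff -> : string_length x (rcons s y) = string_length x s + simplex_dist (vertex_point Kv) y.
  by have := simplex_dist_le1 vy; rewrite -natr1; lra.
rewrite -sv; elim: s (x) {xs sv sn vy xu} => [|z s IHs] t /=; first by rewrite addr0 add0r.
by rewrite IHs addrA.
Qed.

Lemma length_dist_reach n x y u v : fsupport x u -> fsupport y v -> reach K n u v ->
  (length_dist K x y <= (n%:R + 2)%:E)%E.
Proof.
move=> xu yv uv; have Ku := support_vertex xu; have Kv := support_vertex yv.
have [s [xs sy sn]] := string_reach (Ku := Ku) (Kv := Kv) uv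
  (support_common_simplex _ xu) (common_simplex_sym (support_common_simplex _ yv)).
by apply: le_trans (length_dist_string xs sy) _; rewrite lee_fin.
Qed.

Lemma cauchy_schwarz_le (I : Type) (r : seq I) (f g : I -> R) (t : R) : 0 <= t ->
  \sum_(i <- r) g i ^+ 2 <= t ^+ 2 ->
  \sum_(i <- r) f i * g i <= t * Num.sqrt (\sum_(i <- r) f i ^+ 2).
Proof.
move=> t0 gt; set A := \sum_(i <- r) f i ^+ 2.
have A0 : 0 <= A by apply: sumr_ge0 => i _; exact: sqr_ge0.
have quad (a b : R) : 0 <= a ^+ 2 * A + b ^+ 2 * t ^+ 2 - 2 * a * b * \sum_(i <- r) f i * g i.
  apply: (@le_trans _ _ (\sum_(i <- r) (a * f i - b * g i) ^+ 2)).
    by apply: sumr_ge0 => i _; exact: sqr_ge0.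
  have -> : \sum_(i <- r) (a * f i - b * g i) ^+ 2 = a ^+ 2 * A +
      b ^+ 2 * (\sum_(i <- r) g i ^+ 2) - 2 * a * b * \sum_(i <- r) f i * g i.
    rewrite /A !mulr_sumr -big_split -sumrB /=; apply: eq_bigr => i _; ring.
  by have := sqr_ge0 b; have : 0 <= b ^+ 2 * (t ^+ 2 - \sum_(i <- r) g i ^+ 2);
    [apply: mulr_ge0; rewrite ?sqr_ge0 ?subr_ge0 | lra].
set B := \sum_(i <- r) f i * g i in quad *.
have s0 : 0 <= Num.sqrt A := sqrtr_ge0 A.
have sA : Num.sqrt A ^+ 2 = A := sqr_sqrtr A0.
rewrite leNgt; apply/negP => lt.
have B0 : 0 < B by apply: le_lt_trans lt; exact: mulr_ge0.
(* With [A] the square of [s], the pair [(B, A)] gives the contradiction when [s] is positive, and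
   [(t ^+ 2 + 1, B)] when [s] is zero. *)
have := quad B A; have := quad (t ^+ 2 + 1) B.
rewrite -sA; move: (Num.sqrt A) s0 lt => s s0 lt.
have [->|s_neq0] := eqVneq s 0; first by nra.
have s_gt0 : 0 < s by rewrite lt_def s_neq0.
move=> _; have -> : B ^+ 2 * s ^+ 2 + (s ^+ 2) ^+ 2 * t ^+ 2 - 2 * B * s ^+ 2 * B =
  s ^+ 2 * (s ^+ 2 * t ^+ 2 - B ^+ 2) by ring.
rewrite pmulr_rge0 ?exprn_gt0 // subr_ge0 -exprMn leNgt => /negP; apply.
by rewrite ltr_pXn2r ?nnegrE ?mulr_ge0 ?(ltW B0) // mulrC.
Qed.

(** Factor [x v ^+ 2 - y v ^+ 2] and apply Cauchy-Schwarz: the factor [(x v + y v) * c v] has norm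
    at most 2. The normalization of [simplex_dist] contributes sqrt 2, and 2 sqrt 2 is at most 3. *)
Lemma sum_sqr_lipschitz x y S (c : U -> R) :
  simplex K S -> fsupport x `<=` S -> fsupport y `<=` S ->
  (forall v, S v -> 0 <= c v <= 1) ->
  \sum_(v <- fset_set S) x v ^+ 2 * c v <=
  \sum_(v <- fset_set S) y v ^+ 2 * c v + 3 * simplex_dist x y.
Proof.
move=> KS xS yS c01; have Sfin := simplex_finite KS.
rewrite -lerBlDl -sumrB (simplex_distE KS xS yS) sqrtrM; last first.
  by apply: sumr_ge0 => v _; exact: sqr_ge0.
rewrite (eq_bigr (fun v => (x v - y v) * ((x v + y v) * c v))); last by move=> v _; ring.
have g4 : \sum_(v <- fset_set S) ((x v + y v) * c v) ^+ 2 <= 2 ^+ 2.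
  apply: (@le_trans _ _ (\sum_(v <- fset_set S) (2 * x v ^+ 2 + 2 * y v ^+ 2))).
    rewrite big_seq [leRHS]big_seq; apply: ler_sum => v; rewrite in_fset_set // => /set_mem.
    move=> /c01 /andP[c0 c1].
    apply: (@le_trans _ _ ((x v + y v) ^+ 2)); first by rewrite exprMn ler_piMr ?sqr_ge0 ?expr_le1.
    by have := sqr_ge0 (x v - y v); nra.
  rewrite big_split -!mulr_sumr /=.
  have := sum_sqr_le1 KS xS; have := sum_sqr_le1 KS yS; lra.
apply: le_trans (cauchy_schwarz_le _ _ g4) _ => //.
set s := Num.sqrt _; rewrite mulrCA mulrC ler_wpM2l ?sqrtr_ge0 //.
rewrite sqrtrV //; set r := Num.sqrt 2.
have r0 : 0 < r by rewrite sqrtr_gt0.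
have r2 : r ^+ 2 = 2 by rewrite sqr_sqrtr.
rewrite ler_pdivlMr //; nra.
Qed.

(** * Lower bound for the length of strings *)

Section Potential.
Variables (u : U) (Klin : linear_complex K).

Let reachable v := exists n, reach K n u v.
Let depth v := least (fun n => reach K n u v).
(** The minimum is over all vertices that span a simplex together with [S], not only those of [S],
    so that an edge of a simplex already sees the value of the whole simplex. *)
Let apex S := least (fun n => exists2 w, simplex K (S `|` [set w]) & depth w = n).

Let depth_reach v : reachable v -> reach K (depth v) u v.
Proof. by case=> n uv; have [] := leastP (P := fun n => reach K n u v) uv. Qed.

Let reachable_adjacent v w : reachable v -> adjacent K v w -> reachable w.
Proof. by case=> n uv vw; exists n.+1, v. Qed.

Let depth_adjacent v w : reachable v -> adjacent K v w -> (depth w <= (depth v).+1)%N.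
Proof.
move=> /depth_reach uv vw.
by have [|//] := leastP (P := fun n => reach K n u w) (n := (depth v).+1); exists v.
Qed.

Let apex_bounds S v : simplex K S -> S v -> reachable v ->
  (apex S <= depth v <= (apex S).+1)%N.
Proof.
move=> KS Sv uv.
have [|[w Kw dw] le_apex] := leastP (n := depth v)
    (P := fun n => exists2 w, simplex K (S `|` [set w]) & depth w = n).
  exists v => //; suff -> : S `|` [set v] = S by [].
  by apply/seteqP; split => [_ [//|->//]|w Sw]; left.
rewrite le_apex /= /apex -dw; have vw : adjacent K v w.
  by apply: simplex_adjacent Kw _ _; [left|right].
exact: depth_adjacent (reachable_adjacent uv vw) (adjacent_sym vw).
Qed.

(** By linearity, a simplex containing [S'] and [z] can be merged with [S], because both contain [v]
    and [w]. *)
Let apex_sub S S' v w : simplex K S -> S' `<=` S -> v <> w -> S' v -> S' w ->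
  apex S' = apex S.
Proof.
move=> KS S'S vw S'v S'w; rewrite /apex; congr least; apply/funext => n.
apply/propext; split => -[z Kz dz]; exists z => //.
  have -> : S `|` [set z] = (S' `|` [set z]) `|` S.
    by rewrite -setUA (setUC [set z]) setUA (setUidr S'S).
  by apply: (Klin Kz KS vw); [left|left|exact: S'S|exact: S'S].
apply: (simplex_sub (u := v) Kz); first by left.
by move=> x [/S'S|]; [left|right].
Qed.

Let potential x : R := (apex (fsupport x))%:R +
  \sum_(v \in [set: U]) x v ^+ 2 * ((depth v)%:R - (apex (fsupport x))%:R).

Let potentialE x S : simplex K S -> fsupport x `<=` S ->
  potential x = (apex S)%:R + \sum_(v <- fset_set S) x v ^+ 2 * ((depth v)%:R - (apex S)%:R).
Proof.
move=> KS xS; rewrite /potential -(fsum_simplex KS); last first.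
  by move=> v Sv; rewrite (bary0 xS Sv) expr0n mul0r.
have [[v [w [vw xv xw]]]|x1] := pselect (exists v w, [/\ v <> w, fsupport x v & fsupport x w]).
  by rewrite (apex_sub KS xS vw xv xw).
(* Here [x] is a vertex, and the two base values may differ, but they cancel. *)
have [v xv] := fsupport_neq0 x; have Kv := support_vertex xv.
have xE : fsupport x = [set v].
  apply/seteqP; split => [w xw|_ ->//]; have [//|wv] := pselect (w = v).
  by case: x1; exists w, v.
have x0 w : ~ [set v] w -> x w = 0 by apply: bary0; rewrite xE.
have xv1 : x v = 1.
  have := bary_sum_simplex (x := x) Kv; rewrite xE fset_set1 big_seq_fset1; exact.
have sumE (M : R) : \sum_(v \in [set: U]) x v ^+ 2 * ((depth v)%:R - M) = (depth v)%:R - M.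
  rewrite (fsum_simplex Kv) => [|w /x0 ->]; last by rewrite expr0n mul0r.
  by rewrite fset_set1 big_seq_fset1 xv1 expr1n mul1r.
by rewrite !sumE; ring.
Qed.

Let depth_apex01 S v : simplex K S -> S v -> reachable v ->
  0 <= (depth v)%:R - (apex S)%:R :> R /\ (depth v)%:R - (apex S)%:R <= 1 :> R.
Proof.
move=> KS Sv uv; have /andP[le1 le2] := apex_bounds KS Sv uv.
by rewrite subr_ge0 ler_nat lerBlDl natr1 ler_nat.
Qed.

Let potential_step x y : common_simplex x y -> (forall v, fsupport x v -> reachable v) ->
  (forall v, fsupport y v -> reachable v) /\ potential y <= potential x + 3 * simplex_dist x y.
Proof.
move=> [S [KS xS yS]] xr; have Sr v : S v -> reachable v.
  have [w xw] := fsupport_neq0 x => Sv.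
  exact: reachable_adjacent (xr w xw) (simplex_adjacent KS (xS _ xw) Sv).
split=> [v /yS /Sr //|]; rewrite (potentialE KS xS) (potentialE KS yS) -addrA lerD2l.
have -> : simplex_dist x y = simplex_dist y x.
  by rewrite !(simplex_distE KS) //; congr (Num.sqrt (_ / 2)); apply: eq_bigr => v _; ring.
apply: sum_sqr_lipschitz => // v Sv.
by have [c0 c1] := depth_apex01 KS Sv (Sr v Sv); rewrite c0 c1.
Qed.

Let potential_string s x : is_string x s -> (forall v, fsupport x v -> reachable v) ->
  (forall v, fsupport (last x s) v -> reachable v) /\
  potential (last x s) <= potential x + 3 * string_length x s.
Proof.
elim: s x => [|y s IH] x /=; first by rewrite mulr0 addr0.
move=> [xy ys] xr; have [yr pxy] := potential_step xy xr.
have [sr ps] := IH y ys yr; split => //.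
by apply: le_trans ps _; rewrite mulrDr addrA lerD2r.
Qed.

(* On a simplex the depth takes the values [M] and [M + 1] only. The potential
   interpolates it by squares of barycentric coordinates, whose Lipschitz
   constant, unlike that of the affine interpolation, does not depend on the
   dimension of the simplex. Since simplices are glued along vertices, where
   the potential is the depth whatever [M], it is well defined. *)
Lemma string_reach_lower x s v : is_string x s -> fsupport x u -> fsupport (last x s) v ->
  exists n, reach K n u v /\ n%:R <= 3 * string_length x s + 2.
Proof.
move=> xs xu sv; have Kx := bary_simplex x.
have xr w : fsupport x w -> reachable w.
  by move=> xw; exists 1%N; apply/reach1; exact: simplex_adjacent Kx _ _.
have [sr ps] := potential_string xs xr.
exists (depth v); split; first exact/depth_reach/sr.
have Ks := bary_simplex (last x s).
have d0 : depth u = 0%N.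
  by apply/eqP; rewrite -leqn0; have [] := leastP (P := fun n => reach K n u u) (n := 0) erefl.
(* The support of [x] contains [u], of depth 0, so its apex is 0; the potential is then at most the
   sum of the coordinates. *)
have x1 : potential x <= 1.
  have /andP[le1 _] := apex_bounds Kx xu (xr _ xu); rewrite d0 leqn0 in le1.
  rewrite (potentialE Kx) // (eqP le1) add0r.
  rewrite -[leRHS](bary_sum_simplex (x := x) Kx) // big_seq [leRHS]big_seq.
  apply: ler_sum => w; rewrite in_fset_set => [/set_mem xw|]; last exact: simplex_finite Kx.
  have := depth_apex01 Kx xw (xr _ xw); rewrite (eqP le1) => -[c0 c1].
  by apply: le_trans (bary_sqr_le x w); rewrite ler_piMr ?sqr_ge0.
(* The potential is at least the apex, and [v] lies at most one above it. This 1 and the bound 1 at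
   [x] make up the additive constant 2. *)
have : (depth v)%:R - 1 <= potential (last x s).
  rewrite (potentialE Ks) //.
  have /andP[_ le2] := apex_bounds Ks sv (sr _ sv).
  rewrite lerBlDr; apply: (@le_trans _ _ (apex (fsupport (last x s))).+1%:R).
    by rewrite ler_nat.
  rewrite -natr1 lerD2r lerDl big_seq; apply: sumr_ge0 => z.
  rewrite in_fset_set => [/set_mem sz|]; last exact: simplex_finite Ks.
  by rewrite mulr_ge0 ?sqr_ge0 //; have [] := depth_apex01 Ks sz (sr _ sz).
move: ps x1; move: (potential x) (potential _) (string_length x s) => p q l.
by move: (depth v)%:R => d; lra.
Qed.

End Potential.
End LengthBounds.

(** * From strings to the infimum of their lengths *)

Section DistanceBounds.
Variables (R : realType) (U : choiceType) (K : scomplex U).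

(** Solving for the length turns the hypothesis into a lower bound for all strings, hence for their
    infimum; if there is no string, this infimum is +oo. *)
Lemma length_dist_le (D : \bar R) (L C : R) (x y : realization R K) : 0 < L ->
  (forall s, is_string x s -> last x s = y -> (D <= (L * string_length x s + C)%:E)%E) ->
  (D <= L%:E * length_dist K x y + C%:E)%E.
Proof.
move=> L0 DL; rewrite -leeBlDr // -lee_pdivrMl //.
apply/ereal_infP => _ [s [xs sy] <-].
by rewrite lee_pdivrMl // leeBlDr //; exact: DL.
Qed.

(** Dividing by [L] leaves the additive constant [L^-1 * C], which is at most [C] because
    [1 <= L]. *)
Lemma length_dist_ge (D : \bar R) (L C : R) (x y : realization R K) : 1 <= L -> 0 <= C ->
  (forall s, is_string x s -> last x s = y -> (D <= (L * string_length x s + C)%:E)%E) ->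
  ((L^-1)%:E * D - C%:E <= length_dist K x y)%E.
Proof.
move=> L1 C0 DL; have L0 : 0 < L by apply: lt_le_trans L1.
rewrite leeBlDr // lee_pdivrMl //; apply: (le_trans (length_dist_le L0 DL)).
rewrite muleDr ?fin_num_adde_defl // leeD2l // -EFinM lee_fin ler_peMl //.
Qed.

End DistanceBounds.

(** Each edge costs [N]. The extra [N] pays for the start, where [w] and the vertex chosen by the
    induction may be different partners of the same [u]. *)
Lemma reach_transfer (U U' : choiceType) (K : scomplex U) (K' : scomplex U')
    (rel : U -> U' -> Prop) (N n : nat) u u' w w' :
  (forall v, simplex K [set v] -> exists z, rel v z) ->
  (forall v v' z z', adjacent K v v' -> rel v z -> rel v' z' -> reach K' N z z') ->
  simplex K [set u] -> rel u w -> rel u' w' -> reach K n u u' ->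
  reach K' (n.+1 * N) w w'.
Proof.
move=> tot loc Ku uw; elim: n u' w' => [|n IH] u' w' u'w' /=.
  by move=> uu'; rewrite mul1n; apply: loc uw u'w'; rewrite -uu'; exact: adjacent_refl.
move=> [v uv vu']; have [z vz] := tot v (reach_vertex Ku uv).
by rewrite mulSnr; apply: reach_cat (IH _ _ vz uv) (loc _ _ _ _ vu' vz u'w').
Qed.

(** * Quasi-isometries from relations between vertices *)

Section Correspondence.
Variables (R : realType) (U U' : choiceType) (K : scomplex U) (K' : scomplex U').
Variables (rel : U -> U' -> Prop) (N : nat).

Hypotheses (Klin : linear_complex K) (Klin' : linear_complex K').
Hypothesis rel_vertices : forall u w, rel u w -> simplex K [set u] /\ simplex K' [set w].
Hypothesis rel_total : forall u, simplex K [set u] -> exists w, rel u w.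
Hypothesis rel_onto : forall w, simplex K' [set w] -> exists u, rel u w.
Hypothesis rel_local : forall u u' w w',
  adjacent K u u' -> rel u w -> rel u' w' -> reach K' N w w'.
Hypothesis rel_local' : forall u u' w w',
  adjacent K' w w' -> rel u w -> rel u' w' -> reach K N u u'.

(** The map sends a point to a partner of some vertex of its support. A string is cut down to a path
    of vertices by [string_reach_lower], transferred through the relation, and turned back into a
    string. *)
Lemma correspondence_quasi_isometric : complex_quasi_isometric R K K'.
Proof.
have fP (x : realization R K) :
    { y : realization R K' & { u & { w | [/\ fsupport x u, rel u w & fsupport y = [set w]] } } }.
  have [u xu] := cid (fsupport_neq0 x).
  have [w uw] := cid (rel_total (support_vertex xu)).
  have Kw := (rel_vertices uw).2.
  by exists (vertex_point R Kw), u, w; split => //; exact: fsupport_vertex_point.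
(* From [n <= 3 l + 2] one gets [(n + 1) N + 2 <= 3 N l + 3 N + 2]; the slope is raised by 1 so that
   it is at least 1 for every [N]. *)
pose f x := projT1 (fP x); exists f, (3 * N%:R + 1), (3 * N%:R + 2).
have N0 : 0 <= N%:R :> R by exact: ler0n.
have bound (l : R) n : 0 <= l -> n%:R <= 3 * l + 2 ->
    (n.+1 * N)%:R + 2 <= (3 * N%:R + 1) * l + (3 * N%:R + 2).
  move=> l0 nl; have : N%:R * n%:R <= N%:R * (3 * l + 2) by rewrite ler_wpM2l.
  by rewrite natrM -natr1; lra.
split; [lra|lra| |].
- move=> x x'; have [u [w [xu uw yw]]] := projT2 (fP x).
  have [u' [w' [xu' uw' yw']]] := projT2 (fP x').
  have [Ku Kw] := rel_vertices uw; split.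
    apply: length_dist_ge => [||s ys sy']; [lra|lra|].
    have [||n [wn nl]] := string_reach_lower (u := w) (v := w') Klin' ys.
    - by rewrite yw.
    - by rewrite sy' yw'.
    have uu' := reach_transfer (rel := fun w u => rel u w) rel_onto
      (fun v v' z z' vv' vz vz' => rel_local' vv' vz vz') Kw uw uw' wn.
    apply: le_trans (length_dist_reach xu xu' uu') _.
    by rewrite lee_fin; apply: bound => //; exact: string_length_ge0.
  apply: length_dist_le => [|s xs sx']; first by lra.
  have [|n [un nl]] := string_reach_lower (v := u') Klin xs xu; first by rewrite sx'.
  have ww' := reach_transfer rel_total rel_local Ku uw uw' un.
  apply: le_trans (length_dist_reach (u := w) (v := w') _ _ ww') _; rewrite ?yw ?yw' //.
  by rewrite lee_fin; apply: bound => //; exact: string_length_ge0.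
- move=> y; have [w yw] := fsupport_neq0 y.
  have [u uw] := rel_onto (support_vertex yw); have [Ku Kw] := rel_vertices uw.
  exists (vertex_point R Ku); have [u' [w' [u'u uw' y'w']]] := projT2 (fP (vertex_point R Ku)).
  have {u'u} := u'u; rewrite [X in X u']fsupport_vertex_point => u'u; rewrite {u'}u'u in uw'.
  have ww' := rel_local (adjacent_refl Ku) uw' uw.
  apply: le_trans (length_dist_reach (u := w') (v := w) _ yw ww') _; rewrite ?y'w' //.
  by rewrite lee_fin; lra.
Qed.

End Correspondence.

(** * Centralizers in right-angled Artin groups *)

Section IntegerPowers.
Variable G : groupType.
Implicit Types x y : G.

Definition zpow x (n : int) : G :=
  match n with Posz k => (x ^+ k)%g | Negz k => (x ^- k.+1)%g end.

Lemma zpowN x (n : nat) : zpow x (- n%:Z) = (x ^- n)%g.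
Proof. by case: n => [|n]; rewrite ?NegzE ?oppr0 /= ?invg1 // -NegzE. Qed.

Lemma zpowD1 x n : zpow x (n + 1) = (zpow x n * x)%g.
Proof.
elim/int_ind: n => [|n _|n _]; first by rewrite add0r /= expg1 mul1g.
  by rewrite -PoszD addn1 /= expgSr.
have -> : - (n.+1)%:Z + 1 = - n%:Z by lia.
by rewrite !zpowN expgS invgM mulgVK.
Qed.

Lemma zpowB1 x n : zpow x (n - 1) = (zpow x n * x^-1)%g.
Proof. by rewrite -[in RHS](subrK 1 n) zpowD1 mulgK. Qed.

Lemma zpowD x m n : zpow x (m + n) = (zpow x m * zpow x n)%g.
Proof.
elim/int_ind: n => [|n IH|n IH]; first by rewrite addr0 mulg1.
  have -> : n.+1%:Z = n%:Z + 1 by lia.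
  by rewrite addrA !zpowD1 IH mulgA.
have -> : - n.+1%:Z = - n%:Z - 1 by lia.
by rewrite addrA !zpowB1 IH mulgA.
Qed.

Lemma zpowM x m n : zpow x (m * n) = zpow (zpow x m) n.
Proof.
elim/int_ind: n => [|n IH|n IH]; first by rewrite mulr0.
  have -> : n.+1%:Z = n%:Z + 1 by lia.
  by rewrite zpowD1 mulrDr mulr1 zpowD IH.
have -> : - n.+1%:Z = - n%:Z - 1 by lia.
have -> : m * (- n%:Z - 1) = m * (- n%:Z) - m by ring.
rewrite zpowB1 -IH; apply: (mulIg (zpow x m)).
by rewrite mulgVK -zpowD subrK.
Qed.

Lemma conj_zpow (g x : G) n : zpow (g^-1 * x * g)%g n = (g^-1 * zpow x n * g)%g.
Proof.
elim/int_ind: n => [|n IH|n IH]; first by rewrite /= !expg0 mulg1 mulVg.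
  have -> : n.+1%:Z = n%:Z + 1 by lia.
  by rewrite !zpowD1 IH !mulgA mulgK.
have -> : - n.+1%:Z = - n%:Z - 1 by lia.
by rewrite !zpowB1 IH !invgM invgK !mulgA mulgK.
Qed.

End IntegerPowers.

Section RaagTheory.
Variables (T : finType) (e : rel T).
Hypotheses (e_sym : symmetric e) (e_irr : irreflexive e).

Local Notation G := (raag e).
Local Notation gen := (raag_gen e).
Local Notation wd := (\pi_(raag e)).
Local Notation std := (standard_subgroup e).
Implicit Types (a b c d u v : T) (g h x y p t : raag e) (A B : set T) (w : word T).

Definition star a : set T := [set c | c = a \/ e a c].

Lemma pi_cat w w' : wd (w ++ w') = (wd w * wd w')%g.
Proof. by symmetry; exact: raag_mulE. Qed.

Lemma pi_letter a (s : bool) : wd [:: (a, s)] = (if s then gen a else (gen a)^-1)%g.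
Proof.
case: s => //; apply: (mulgI (gen a)); rewrite mulgV -[gen a]/(wd [:: (a, true)]) -pi_cat.
by apply/raagP; exact: (word_eq_cancel e [::] [::]).
Qed.

Lemma gen_commute a b : e a b -> commute (gen a) (gen b).
Proof.
move=> ab; rewrite /commute -!pi_cat.
by apply/raagP; exact: (word_eq_comm [::] [::]).
Qed.

(** * Signed counts of letters with prefix in a given set *)

Section Count.
Variables (a : T) (S : set G).

(** The word is an edge path from [p] in the Cayley graph. An edge labelled [a] is tested at its
    initial end, which for an inverse letter is the point reached after reading it. *)
Fixpoint word_count p w : int :=
  if w is (c, b) :: w' then
    (if c == a then
       if b then (`[< S p >])%:Z else - (`[< S (p * wd [:: (c, b)])%g >])%:Z
     else 0) + word_count (p * wd [:: (c, b)])%g w'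
  else 0.

Lemma word_count_cat p w w' :
  word_count p (w ++ w') = word_count p w + word_count (p * wd w)%g w'.
Proof.
elim: w p => [|[c b] w IH] p /=; first by rewrite add0r mulg1.
by rewrite IH -mulgA -pi_cat addrA.
Qed.

Hypothesis S_link : forall p c, e a c -> S p <-> S (p * gen c)%g.

(** A cancelling pair crosses one edge in both directions. In a commutation square, the two edges
    labelled [a] start at points that differ by a generator of the link, which [S] does not
    distinguish. *)
Lemma word_count_eq w w' : word_eq e w w' -> forall p, word_count p w = word_count p w'.
Proof.
elim=> {w w'} [//|w w' _ IH p|w w' w'' _ IH _ IH' p|w w' c b p|w w' c d cd p].
- by rewrite IH.
- by rewrite IH IH'.
- have cancel : wd [:: (c, b); (c, ~~ b)] = 1%g.
    by apply/raagP; exact: (word_eq_cancel e [::] [::]).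
  rewrite !(word_count_cat p) (word_count_cat _ [:: _; _]) cancel mulg1.
  congr (_ + _); rewrite -[RHS]add0r; congr (_ + _); move: (p * wd w)%g => q.
  rewrite /= -mulgA -pi_cat /= cancel mulg1 addr0.
  by case: eqP => _; rewrite ?addr0 //; case: b {cancel}; rewrite /= ?addrN ?addNr.
- have swap : wd [:: (c, true); (d, true)] = wd [:: (d, true); (c, true)].
    by apply/raagP; exact: (word_eq_comm [::] [::]).
  rewrite !(word_count_cat p) (word_count_cat _ [:: (c, true); _]).
  rewrite (word_count_cat _ [:: (d, true); _]) swap.
  congr (_ + (_ + _)); rewrite /= !addr0.
  case: eqP => [ca|_]; case: eqP => [da|_]; rewrite ?add0r ?addr0 //.
  + by move: cd; rewrite ca da e_irr.
  + by congr (Posz (nat_of_bool _)); apply: asbool_equiv_eq; apply: S_link; rewrite -ca.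
  + congr (Posz (nat_of_bool _)); apply: asbool_equiv_eq; apply: iff_sym.
    by apply: S_link; rewrite -da e_sym.
Qed.

Definition count p g : int := word_count p (repr g).

Lemma count_pi p w : count p (wd w) = word_count p w.
Proof. by apply: word_count_eq; apply/raagP; rewrite reprK. Qed.

Lemma countM p g h : count p (g * h)%g = count p g + count (p * g)%g h.
Proof. by rewrite -[g]reprK -[h]reprK -pi_cat !count_pi word_count_cat. Qed.

Lemma count1 p : count p 1%g = 0.
Proof. by rewrite -[1%g]/(wd [::]) count_pi. Qed.

Lemma count_gen p c : count p (gen c) = if c == a then (`[< S p >])%:Z else 0.
Proof. by rewrite count_pi /= addr0. Qed.

Lemma count_genV p c :
  count p (gen c)^-1%g = if c == a then - (`[< S (p * (gen c)^-1)%g >])%:Z else 0.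
Proof. by rewrite -(pi_letter c false) count_pi /= addr0. Qed.

Lemma count_transl x p g : (forall q, S (x * q)%g <-> S q) -> count (x * p)%g g = count p g.
Proof.
move=> xS; rewrite /count; elim: (repr g) p => [//|[c b] w IH] p /=.
by rewrite -!mulgA IH !(asbool_equiv_eq (xS _)).
Qed.

End Count.

Lemma setT_link a p c : e a c -> [set: G] p <-> [set: G] (p * gen c)%g.
Proof. by []. Qed.

Definition expo a g : int := count a setT 1%g g.

Lemma count_setT a p g : count a setT p g = expo a g.
Proof. by rewrite -[p]mulg1 /expo; apply: count_transl. Qed.

Lemma expoM a g h : expo a (g * h)%g = expo a g + expo a h.
Proof. by rewrite {1}/expo (countM (@setT_link a)) !count_setT. Qed.

Lemma expo1 a : expo a 1%g = 0.
Proof. by rewrite /expo (count1 (@setT_link a)). Qed.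

Lemma expoV a g : expo a g^-1%g = - expo a g.
Proof. by apply/eqP; rewrite -addr_eq0 -expoM mulVg expo1. Qed.

Lemma expo_gen a c : expo a (gen c) = (c == a)%:Z.
Proof. by rewrite /expo (count_gen (@setT_link a)) asboolT //; case: eqP. Qed.

Lemma expoX a g n : expo a (g ^+ n)%g = expo a g * n%:Z.
Proof.
elim: n => [|n IH]; first by rewrite expg0 expo1 mulr0.
by rewrite expgSr expoM IH; lia.
Qed.

Lemma expo_zpow a g n : expo a (zpow g n) = expo a g * n.
Proof. by case: n => n; rewrite /= ?expoV expoX ?NegzE // mulrN. Qed.

Lemma expo_conj a g h : expo a (h * g * h^-1)%g = expo a g.
Proof. by rewrite !expoM expoV addrAC subrr add0r. Qed.

(** * Standard subgroups *)

Lemma std_gen A a : A a -> std A (gen a).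
Proof. by move=> Aa; apply: sub_gen_smallest; exists a. Qed.

Lemma std_subgroup A : is_subgroup (std A).
Proof.
split=> [X [[X1 _] _]//|g h Ag Ah X [XG XA]].
by apply: XG.2; [exact: Ag|exact: Ah].
Qed.

Lemma std1 A : std A 1%g. Proof. exact: (std_subgroup A).1. Qed.

Lemma stdV A g : std A g -> std A g^-1%g.
Proof. by move=> Ag; rewrite -[g^-1%g]mul1g; apply: (std_subgroup A).2 => //; exact: std1. Qed.

Lemma stdM A g h : std A g -> std A h -> std A (g * h)%g.
Proof. by move=> Ag Ah; rewrite -[h]invgK; apply: (std_subgroup A).2 => //; exact: stdV. Qed.

Lemma stdMr A g h : std A h -> std A (g * h)%g <-> std A g.
Proof. by move=> Ah; split=> [/stdM/(_ (stdV Ah))|/stdM/(_ Ah)//]; rewrite mulgK. Qed.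

Lemma stdMl A g h : std A g -> std A (g * h)%g <-> std A h.
Proof. by move=> Ag; split=> [/(stdM (stdV Ag))|/(stdM Ag)//]; rewrite mulKg. Qed.

Lemma stdX A g n : std A g -> std A (g ^+ n)%g.
Proof. by move=> Ag; elim: n => [|n IH]; [exact: std1|rewrite expgS; exact: stdM]. Qed.

Lemma std_zpow A g n : std A g -> std A (zpow g n).
Proof. by move=> Ag; case: n => n; [|apply: stdV]; exact: stdX. Qed.

Lemma std_ind A (P : G -> Prop) : P 1%g ->
  (forall g a, A a -> std A g -> P g -> P (g * gen a)%g /\ P (g * (gen a)^-1)%g) ->
  forall g, std A g -> P g.
Proof.
move=> P1 PM; pose Q g := std A g /\ P g.
(* The elements that preserve [Q] under right multiplication, together with their inverses, form a
   subgroup containing the generators. *)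
suff sub : std A `<=` [set g | forall h, Q h -> Q (h * g)%g /\ Q (h * g^-1)%g].
  by move=> g /sub /(_ 1%g) []; [split=> //; exact: std1 | rewrite mul1g => -[]].
apply: smallest_sub => [|_ [a Aa <-] h [Ah Ph]].
  split=> [h Ph|x y Px Py h Ph]; first by rewrite invg1 !mulg1.
  split; first by rewrite mulgA; apply: (Py _ _).2; exact: (Px _ _).1.
  by rewrite invgM invgK mulgA; apply: (Px _ _).2; exact: (Py _ _).1.
have [Pa PVa] := PM h a Aa Ah Ph.
by split; split => //; apply: stdM => //; [|apply: stdV]; exact: std_gen.
Qed.

Lemma std_setT g : std setT g.
Proof.
rewrite -[g]reprK; elim: (repr g) => [|[a b] w IH]; first exact: std1.
rewrite -cat1s pi_cat pi_letter; apply: stdM => //.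
by case: b; [|apply: stdV]; exact: std_gen.
Qed.

Lemma stdS A B : A `<=` B -> std A `<=` std B.
Proof.
move=> AB; apply: std_ind => [|g a Aa _ Bg]; first exact: std1.
have Ba := std_gen (AB _ Aa).
by split; apply: stdM => //; exact: stdV.
Qed.

Lemma std_commute A x : (forall a, A a -> commute x (gen a)) ->
  forall g, std A g -> commute x g.
Proof.
move=> xA; apply: std_ind => [|g a Aa _ xg]; first exact: commute1.
by split; apply: commuteM => //; [|apply: commuteV]; exact: xA.
Qed.

Lemma std_expo0 A a g : std A g -> ~ A a -> expo a g = 0.
Proof.
move=> Ag Aa; elim/std_ind: Ag => [|{}g c Ac _ g0]; first exact: expo1.
by rewrite !expoM expoV g0 expo_gen; case: eqP => // ca; case: Aa; rewrite -ca.
Qed.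

Lemma std0 g : std set0 g -> g = 1%g.
Proof. by move=> g0; elim/std_ind: g0. Qed.

Lemma std_gen_inv A a : std A (gen a) -> A a.
Proof.
move=> Aa; apply: contrapT => nAa.
by have := std_expo0 Aa nAa; rewrite expo_gen eqxx.
Qed.

(* The signed count of the [a]-letters whose prefix lies in [S] comes from the Fox
   derivative along [a]: it is a group invariant as soon as [S] is stable under
   right multiplication by the link of [a], and [expo] is the case [S = setT].
   For [S] generated by the star of [a], computing the count of [g * x = x * g] in
   two ways shows that the one of [x] read from [g] is the exponent of [a] in [x];
   when [g] is not in [S], it is zero. *)
Lemma centralizer_star a x g : std (star a) x -> expo a x <> 0 -> commute g x ->
  std (star a) g.
Proof.
move=> Sx x0 gx; apply: contrapT => Sg; apply: x0.
pose S := std (star a).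
have S_link p c : e a c -> S p <-> S (p * gen c)%g.
  by move=> ac; apply: iff_sym; apply: stdMr; apply: std_gen; right.
have countS p : S p -> count a S p x = expo a x.
  move=> Sp; elim/std_ind: Sx {gx} => [|{}x c Sc Sx IH].
    by rewrite (count1 S_link) expo1.
  have Sxc := stdM Sx (stdV (std_gen Sc)).
  rewrite !(countM S_link) !expoM IH expoV expo_gen (count_gen S_link) (count_genV S_link).
  rewrite !asboolT; first by case: eqP.
    by rewrite -mulgA; exact: stdM.
  exact: stdM.
have countNS p : ~ S p -> count a S p x = 0.
  move=> Sp; elim/std_ind: Sx {gx countS} => [|{}x c Sc Sx IH].
    by rewrite (count1 S_link).
  have Sxc := stdM Sx (stdV (std_gen Sc)).
  rewrite !(countM S_link) IH (count_gen S_link) (count_genV S_link) !asboolF; first by case: eqP.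
    by rewrite -mulgA => /(stdMr p Sxc).
  by move=> /(stdMr p Sx).
have := congr1 (count a S 1%g) gx; rewrite !(countM S_link) !mul1g.
rewrite (countS 1%g); last exact: std1.
have -> : count a S x g = count a S 1%g g.
  by rewrite -{1}[x]mulg1 count_transl // => q; exact: (stdMl q Sx).
by rewrite (countNS g) // addr0 [RHS]addrC -[LHS]addr0 => /addrI.
Qed.

(** * Retractions onto standard subgroups *)

Definition retract_word A w : word T := [seq x <- w | `[< A x.1 >]].

(** Deleting the letters outside [A] turns each defining relation into a relation or a trivial
    identity. *)
Lemma retract_word_eq A w w' : word_eq e w w' -> word_eq e (retract_word A w) (retract_word A w').
Proof.
elim=> {w w'} [w|w w' _ IH|w w' w'' _ IH _ IH'|w w' c b|w w' c d cd].
- exact: word_eq_refl.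
- exact: word_eq_sym.
- exact: word_eq_trans IH IH'.
- rewrite /retract_word !filter_cat /=; case: `[< A c >]; last exact: word_eq_refl.
  exact: word_eq_cancel.
- rewrite /retract_word !filter_cat /=; case: `[< A c >]; case: `[< A d >]; try exact: word_eq_refl.
  exact: word_eq_comm.
Qed.

Definition retract A g : G := wd (retract_word A (repr g)).

Lemma retract_pi A w : retract A (wd w) = wd (retract_word A w).
Proof. by apply/raagP/retract_word_eq/raagP; rewrite reprK. Qed.

Lemma retractM A g h : retract A (g * h)%g = (retract A g * retract A h)%g.
Proof.
rewrite -[g]reprK -[h]reprK -pi_cat !retract_pi -pi_cat.
by rewrite /retract_word filter_cat.
Qed.

Lemma retract1 A : retract A 1%g = 1%g.
Proof. exact: (retract_pi A [::]). Qed.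

Lemma retractV A g : retract A g^-1%g = (retract A g)^-1%g.
Proof. by apply: (mulgI (retract A g)); rewrite -retractM !mulgV retract1. Qed.

Lemma retract_gen A a : A a -> retract A (gen a) = gen a.
Proof. by move=> Aa; rewrite retract_pi /retract_word /= asboolT. Qed.

Lemma retract_gen1 A a : ~ A a -> retract A (gen a) = 1%g.
Proof. by move=> Aa; rewrite retract_pi /retract_word /= asboolF. Qed.

Lemma retract_stdI A B g : std B g -> std (A `&` B) (retract A g).
Proof.
move=> Bg; elim/std_ind: Bg => [|{}g a Ba _ IH]; first by rewrite retract1; exact: std1.
rewrite !retractM retractV; have [Aa|Aa] := pselect (A a).
  by rewrite retract_gen //; have ABa : std (A `&` B) (gen a) by [exact: std_gen];
     split; apply: stdM => //; exact: stdV.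
by rewrite retract_gen1 // invg1 mulg1.
Qed.

Lemma retract_std A g : std A (retract A g).
Proof. by have := retract_stdI (A := A) (std_setT g); rewrite setIT. Qed.

Lemma retract_id A g : std A g -> retract A g = g.
Proof.
move=> Ag; elim/std_ind: Ag => [|{}g a Aa _ IH]; first exact: retract1.
by rewrite !retractM retractV IH retract_gen.
Qed.

(** The retraction onto [A] fixes [g], while it maps the subgroup of [B] into that of the
    intersection. *)
Lemma stdI A B g : std A g -> std B g -> std (A `&` B) g.
Proof. by move=> Ag Bg; rewrite -(retract_id Ag); exact: retract_stdI. Qed.

(** Since [a] commutes with [B], the subgroup is a product of the powers of [a] and [std B]; the
    exponent and the retraction read off the two factors. *)
Lemma std_decomp a B g : ~ B a -> (forall b, B b -> e a b) -> std (a |` B) g ->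
  g = (zpow (gen a) (expo a g) * retract B g)%g.
Proof.
move=> nBa aB; have aBcomm h : std B h -> commute (gen a) h.
  by apply: std_commute => c /aB; exact: gen_commute.
move=> aBg; elim/std_ind: aBg => [|{}g c aBc _ IH]; first by rewrite expo1 retract1 mulg1.
rewrite !expoM !retractM expoV retractV expo_gen.
have ra := aBcomm _ (@retract_std B g).
have [ca|ca] := eqVneq c a; last first.
  have Bc : B c by case: aBc => // /eqP; rewrite (negPf ca).
  by rewrite retract_gen //= oppr0 addr0 !mulgA -IH.
rewrite ca retract_gen1 // invg1 mulg1 zpowD1 zpowB1 -!mulgA.
by rewrite ra (commute_sym (commuteV (commute_sym ra))) !mulgA -IH.
Qed.

Lemma pair_decomp a b g : e a b -> std [set a; b] g ->
  g = (zpow (gen a) (expo a g) * zpow (gen b) (expo b g))%g.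
Proof.
move=> ab abg; have nab : ~ [set b] a by move=> /= a_b; move: ab; rewrite a_b e_irr.
have gE := std_decomp nab _ abg; rewrite {1}gE; last by move=> _ ->.
have rb : std (b |` set0) (retract [set b] g) by rewrite setU0; exact: retract_std.
have rE : retract [set b] g = zpow (gen b) (expo b (retract [set b] g)).
  by rewrite {1}(std_decomp _ _ rb) // (std0 (@retract_std _ _)) mulg1.
rewrite {1}rE; congr (_ * zpow _ _)%g.
rewrite {2}gE; last by move=> _ ->.
rewrite expoM expo_zpow expo_gen; case: eqP => [a_b|_]; last by rewrite mul0r add0r.
by case: nab.
Qed.

Lemma pair_eq a b g h : e a b -> std [set a; b] g -> std [set a; b] h ->
  expo a g = expo a h -> expo b g = expo b h -> g = h.
Proof. by move=> ab abg abh ga gb; rewrite (pair_decomp ab abg) (pair_decomp ab abh) ga gb. Qed.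

Lemma pair_expo_neq0 a b g : e a b -> std [set a; b] g -> g <> 1%g ->
  exists v, expo v g <> 0.
Proof.
move=> ab abg g1; apply: contrapT => gv; apply: g1; apply: (pair_eq ab abg (@std1 _)).
  by rewrite expo1; apply: contrapT => ga; apply: gv; exists a.
by rewrite expo1; apply: contrapT => ga; apply: gv; exists b.
Qed.

Lemma edge_other a b v : e a b -> [set a; b] v ->
  exists2 p, e v p & [set a; b] = [set v; p].
Proof. by move=> ab [] ->; [exists b|exists a; rewrite 1?e_sym 1?setUC]. Qed.

Lemma edge_star a b : e a b -> [set a; b] `<=` star a.
Proof. by move=> ab _ [] ->; [left|right]. Qed.

(* Conjugate elements of two subgroups generated by an edge are equal, because
   they have the same exponents. *)
Lemma conjugate_pairs a b c d x y t v : e a b -> e c d ->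
  std [set a; b] x -> std [set c; d] y -> x = (t * y * t^-1)%g -> expo v x <> 0 ->
  [/\ [set a; b] v, [set c; d] v & std (star v) t].
Proof.
move=> ab cd abx cdy xy vx.
have exy u : expo u x = expo u y by rewrite xy expo_conj.
have abv : [set a; b] v by apply: contrapT => /(std_expo0 abx).
have cdv : [set c; d] v.
  by apply: contrapT => /(std_expo0 cdy); rewrite -exy.
split => //; have [p vp abE] := edge_other ab abv; have [q vq cdE] := edge_other cd cdv.
rewrite abE in abx; rewrite cdE in cdy.
(* If the other ends [p] and [q] differ, equality of exponents makes those along [p] and [q] vanish,
   and both elements are the same power of [v]. *)
have xyE : x = y.
  rewrite (pair_decomp vp abx) (pair_decomp vq cdy) exy; congr (_ * _)%g.
  have [<-|pq] := eqVneq p q; first by rewrite exy.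
  have vNp : v <> p by move=> v_p; move: vp; rewrite v_p e_irr.
  have vNq : v <> q by move=> v_q; move: vq; rewrite v_q e_irr.
  rewrite exy (std_expo0 cdy) => [|[/esym//|/eqP]]; last by rewrite (negPf pq).
  by rewrite -exy (std_expo0 abx) // => -[/esym//|/esym/eqP]; rewrite (negPf pq).
apply: (centralizer_star _ vx); first exact: stdS (edge_star vp) _ abx.
by rewrite /commute {1}xyE [in RHS]xy mulgVK.
Qed.

(** [centralizer_star] puts the conjugate into the subgroup of the star of [v]. Its exponent 1 in
    [u] puts [u] into the star, and retracting the conjugate replaces [g] by its retraction. *)
Lemma commuting_conjugates u v g : commute (g * gen u * g^-1)%g (gen v) ->
  exists k, [/\ std (star v) k, (g * gen u * g^-1 = k * gen u * k^-1)%g & star v u].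
Proof.
move=> gu; have svg : std (star v) (g * gen u * g^-1)%g.
  apply: centralizer_star (gu); first by apply: std_gen; left.
  by rewrite expo_gen eqxx.
have svu : star v u.
  apply: contrapT => nsvu; have := std_expo0 svg nsvu.
  by rewrite expo_conj expo_gen eqxx.
exists (retract (star v) g); split => //; first exact: retract_std.
by rewrite -(retract_id svg) !retractM retractV retract_gen.
Qed.

Lemma commute_gens a b : commute (gen a) (gen b) -> star b a.
Proof.
move=> ab; have [|k [_ _ //]] := @commuting_conjugates a b 1%g.
by rewrite mul1g invg1 mulg1.
Qed.

Lemma star_commute v g : std (star v) g -> commute (gen v) g.
Proof. by apply: std_commute => c [->|/gen_commute//]; exact: commute_refl. Qed.

(** * Cosets and conjugates of standard subgroups *)

Lemma left_cosetP A g h : left_coset g (std A) h <-> std A (g^-1 * h)%g.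
Proof.
split=> [[x Ax <-]|Agh]; first by rewrite mulKg.
by exists (g^-1 * h)%g => //; rewrite mulVKg.
Qed.

Lemma conj_setP A g x : conj_set g (std A) x <-> std A (g^-1 * x * g)%g.
Proof.
split=> [[y Ay <-]|Ax]; first by rewrite !mulgA mulVg mul1g mulgVK.
by exists (g^-1 * x * g)%g => //; rewrite !mulgA mulgV mul1g mulgK.
Qed.

Lemma left_coset_eq A g h : std A (g^-1 * h)%g -> left_coset g (std A) = left_coset h (std A).
Proof.
move=> Agh; have xE x : (g^-1 * x = (g^-1 * h) * (h^-1 * x))%g by rewrite !mulgA mulgK.
apply/seteqP; split=> x /left_cosetP Ax; apply/left_cosetP.
  by apply/(stdMl _ Agh); rewrite -xE.
by rewrite xE; exact: stdM.
Qed.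

Lemma left_coset_inj A B g h : left_coset g (std A) = left_coset h (std B) ->
  std A = std B /\ std A (g^-1 * h)%g.
Proof.
move=> gh; have Agh : std A (g^-1 * h)%g.
  by apply/left_cosetP; rewrite gh; apply/left_cosetP; rewrite mulVg; exact: std1.
split => //; rewrite (left_coset_eq Agh) in gh.
apply/seteqP; split => x xs; rewrite -(mulKg h x); apply/left_cosetP.
  by rewrite -gh; apply/left_cosetP; rewrite mulKg.
by rewrite gh; apply/left_cosetP; rewrite mulKg.
Qed.

Lemma conj_set_coset A B g h : left_coset g (std A) = left_coset h (std B) ->
  conj_set g (std A) = conj_set h (std B).
Proof.
move=> /left_coset_inj[<- Agh]; have AVgh := stdV Agh.
have conjE x : (g^-1 * x * g = (g^-1 * h) * (h^-1 * x * h) * (g^-1 * h)^-1)%g.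
  by rewrite invgM invgK !mulgA !mulgK.
apply/seteqP; split => x /conj_setP Ax; apply/conj_setP; move: Ax; rewrite conjE.
  by move=> /(stdMr _ AVgh) /(stdMl _ Agh).
by move=> Ax; apply/(stdMr _ AVgh)/(stdMl _ Agh).
Qed.

End RaagTheory.

(** * Graphs as complexes *)

Section Graphs.
Variables (U : choiceType) (V : set U) (E : U -> U -> Prop).
Local Notation K := (graph_complex V E).

Lemma graph_vertexP v : simplex K [set v] <-> V v.
Proof.
split=> [[[w Vw /esym vw]|[u [w [Vu _ _ _ vuw]]]]|Vv]; last by left; exists v.
  by have <- : w = v by have : [set v] w by rewrite -vw.
by have <- : u = v by have : [set v] u by rewrite vuw; left.
Qed.

Lemma graph_adjacent u v : V u -> V v -> E u v -> adjacent K u v.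
Proof.
move=> Vu Vv Euv; have [<-|uv] := pselect (u = v); last by right; exists u, v.
exact/adjacent_refl/graph_vertexP.
Qed.

Lemma graph_simplexE S u v : simplex K S -> u <> v -> S u -> S v -> S = [set u; v].
Proof.
move=> KS uv; case: KS => [[w _ ->] /= uw vw|[w [z [_ _ _ _ ->]]]].
  by case: uv; rewrite uw vw.
by move=> [] uE [] vE; move: uv; rewrite uE vE // setUC.
Qed.

Lemma graph_adjacentE u v : (forall x y, E x y -> E y x) ->
  adjacent K u v -> u = v \/ E u v.
Proof.
move=> Esym uv; have [|nuv] := pselect (u = v); [by left|right].
case: uv => [[w _ uvw]|[w [z [_ _ _ Ewz uvwz]]]].
  have uw : [set w] u by rewrite -uvw; left.
  by have vw : [set w] v by [rewrite -uvw; right]; case: nuv; rewrite uw vw.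
have uwz : [set w; z] u by rewrite -uvwz; left.
have vwz : [set w; z] v by rewrite -uvwz; right.
by case: uwz nuv => ->; case: vwz => -> // _; exact: Esym.
Qed.

Lemma graph_linear : linear_complex K.
Proof.
move=> S S' u v KS KS' uv Su Sv S'u S'v.
by rewrite (graph_simplexE KS uv Su Sv) (graph_simplexE KS' uv S'u S'v) setUid;
  rewrite -(graph_simplexE KS uv Su Sv).
Qed.

End Graphs.

(** * The coset intersection complex *)

Section CosetComplex.
Variables (T : finType) (e : rel T).
Hypotheses (e_sym : symmetric e) (e_irr : irreflexive e) (e_tri : triangle_free e).
Hypothesis e_nbr : forall v : T, exists p, e v p.
Hypothesis T_neq0 : inhabited T.

Local Notation G := (raag e).
Local Notation gen := (raag_gen e).
Local Notation std := (standard_subgroup e).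
Local Notation K := (coset_intersection_complex (max_standard_abelian e)).
Implicit Types (a b c d u v w p q : T) (g h x y t : raag e) (A : set T) (S : set (set G)).

Definition pair_coset g a b : set G := left_coset g (std [set a; b]).

Lemma star_pair u v w : e u v -> star e u w -> star e v w -> [set u; v] w.
Proof.
move=> uv [->|uw]; first by left.
by case=> [->|vw]; [right|case: (e_tri (And3 uv vw uw))].
Qed.
Lemma std_star_pair u v t : e u v -> std (star e u) t -> std (star e v) t -> std [set u; v] t.
Proof.
move=> uv ut vt; apply: stdS (stdI ut vt) => w [uw vw].
exact: star_pair uv uw vw.
Qed.

Lemma pair_abelian a b : e a b -> is_abelian (std [set a; b]).
Proof.
move=> ab x y abx aby; apply: (std_commute _ aby) => c abc.
apply: commute_sym; apply: (std_commute _ abx) => d abd.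
have [p cp E] := edge_other e_sym ab abc; rewrite E in abd.
by case: abd => ->; [exact: commute_refl|exact: gen_commute].
Qed.

(** Elements of [A] are pairwise equal or adjacent, so without triangles there are at most two of
    them. Smaller sets are completed to an edge by a neighbour. *)
Lemma abelian_sub_pair A : is_abelian (std A) -> exists a b, e a b /\ A `<=` [set a; b].
Proof.
move=> abA; have Acomm c d : A c -> A d -> star e c d.
  move=> Ac Ad; apply: commute_gens => //; apply: abA; exact: std_gen.
have [[a Aa]|A0] := pselect (exists a, A a); last first.
  have [a] := T_neq0; have [b ab] := e_nbr a; exists a, b; split => // c Ac.
  by case: A0; exists c.
have [[b [Ab ba]]|Aa1] := pselect (exists b, A b /\ b <> a).
  have ab : e a b by case: (Acomm _ _ Aa Ab).
  by exists a, b; split => // c Ac; exact: star_pair ab (Acomm _ _ Aa Ac) (Acomm _ _ Ab Ac).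
have [b ab] := e_nbr a; exists a, b; split => // c Ac; left.
by apply: contrapT => ca; apply: Aa1; exists c.
Qed.

Lemma max_standard_abelianP (P : set G) :
  max_standard_abelian e P <-> exists a b, e a b /\ P = std [set a; b].
Proof.
have std_pair a b : e a b -> standard_abelian e (std [set a; b]).
  by move=> ab; split; [exists [set a; b] | exact: pair_abelian].
split=> [[[[A ->] abA] maxA]|[a [b [ab ->]]]].
  have [a [b [ab Aab]]] := abelian_sub_pair abA.
  by exists a, b; split => //; rewrite (maxA _ (std_pair _ _ ab)) //; exact: stdS.
split; first exact: std_pair.
move=> _ [[A ->] abA] abA'; have [c [d [cd Acd]]] := abelian_sub_pair abA.
have Aab u : [set a; b] u -> A u.
  by move=> abu; exact: (std_gen_inv e_sym e_irr (abA' _ (std_gen abu))).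
have cda : [set c; d] a by apply/Acd/Aab; left.
have cdb : [set c; d] b by apply/Acd/Aab; right.
have [p ap E] := edge_other e_sym cd cda; rewrite E in cdb Acd.
case: cdb => [ba|bp]; first by move: ab; rewrite ba e_irr.
by congr standard_subgroup; apply/seteqP; split => // u /Acd; rewrite bp.
Qed.

Lemma cosetsP (C : set G) :
  cosets (max_standard_abelian e) C <-> exists g a b, e a b /\ C = pair_coset g a b.
Proof.
split=> [[g [Q [/max_standard_abelianP[a [b [ab ->]]] ->]]]|[g [a [b [ab ->]]]]].
  by exists g, a, b.
by exists g, (std [set a; b]); split => //; apply/max_standard_abelianP; exists a, b.
Qed.

Lemma coset_conj_interP S x : coset_conj_inter (max_standard_abelian e) S x <->
  forall g a b, e a b -> S (pair_coset g a b) -> std [set a; b] (g^-1 * x * g)%g.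
Proof.
split=> [xS g a b ab Sg|xS g _ /max_standard_abelianP[a [b [ab ->]]] Sg].
  by apply/conj_setP; apply: xS => //; apply/max_standard_abelianP; exists a, b.
by apply/conj_setP; exact: xS.
Qed.

(** The powers of [x] stay in the intersection and are told apart by their exponents in [v]. *)
Lemma coset_simplexI S x v : finite_set S -> S !=set0 ->
  S `<=` cosets (max_standard_abelian e) ->
  coset_conj_inter (max_standard_abelian e) S x -> expo v x <> 0 -> simplex K S.
Proof.
move=> Sfin S0 SP /coset_conj_interP xS xv; split => // Ifin; apply: infinite_nat.
pose f n := (x ^+ n)%g.
have -> : [set: nat] = f @^-1` coset_conj_inter (max_standard_abelian e) S.
  apply/seteqP; split => n // _; apply/coset_conj_interP => g a b ab Sg.
  by have := std_zpow n (xS g a b ab Sg); rewrite conj_zpow.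
apply: finite_preimage => // m n _ _ /(congr1 (expo v)).
by rewrite /f !expoX // => /(mulfI (introN eqP xv)) [].
Qed.

Lemma coset_simplex_element S : simplex K S ->
  exists2 x, x <> 1%g & coset_conj_inter (max_standard_abelian e) S x.
Proof.
case=> _ _ _ inf; apply: contrapT => no_x; apply: inf.
apply: (sub_finite_set _ (finite_set1 1%g)) => x xS /=.
by apply: contrapT => x1; apply: no_x; exists x.
Qed.

Lemma pair_coset_adjacent g h a b c d x v : e a b -> e c d ->
  std [set a; b] (g^-1 * x * g)%g -> std [set c; d] (h^-1 * x * h)%g -> expo v x <> 0 ->
  adjacent K (pair_coset g a b) (pair_coset h c d).
Proof.
move=> ab cd abx cdx; apply: coset_simplexI.
- by rewrite finite_setU; split; exact: finite_set1.
- by exists (pair_coset g a b); left.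
- by move=> _ [] ->; apply/cosetsP; [exists g, a, b|exists h, c, d].
- by apply/coset_conj_interP => k i j ij [] /conj_set_coset E; apply/conj_setP;
    rewrite E; apply/conj_setP.
Qed.

Lemma expo_conjV v g x : expo v (g^-1 * x * g)%g = expo v x.
Proof. by rewrite -[X in (_ * X)%g]invgK expo_conj. Qed.

(** The elements [g^-1 * x * g] and [h^-1 * x * h] of two edge subgroups are conjugate by
    [g^-1 * h], so [conjugate_pairs] applies. *)
Lemma pair_coset_simplex S g h a b c d x v : e a b -> e c d ->
  S (pair_coset g a b) -> S (pair_coset h c d) ->
  coset_conj_inter (max_standard_abelian e) S x -> expo v x <> 0 ->
  [/\ [set a; b] v, [set c; d] v & std (star e v) (g^-1 * h)%g].
Proof.
move=> ab cd Sg Sh /coset_conj_interP xS xv.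
apply: (conjugate_pairs e_sym e_irr ab cd (xS g a b ab Sg) (xS h c d cd Sh)).
  by rewrite invgM invgK !mulgA !mulgK.
by rewrite expo_conjV.
Qed.

(** Two distinct cosets [C] and [D] share a single direction [v]. Elements witnessing [S] and [S']
    are thus powers of the same conjugate of [v], and a common power of them witnesses the union. *)
Lemma coset_complex_linear : linear_complex K.
Proof.
move=> S S' C D KS KS' CD SC SD S'C S'D.
have [_ _ SP _] := KS; have [_ _ S'P _] := KS'.
have /cosetsP[g [a [b [ab Cg]]]] := SP _ SC; have /cosetsP[h [c [d [cd Dh]]]] := SP _ SD.
rewrite {}Cg {}Dh in CD SC SD S'C S'D.
have [x x1 xS] := coset_simplex_element KS; have [y y1 yS'] := coset_simplex_element KS'.
(* Two shared directions would make both edges equal to that of [v] and [w], and [g^-1 * h] an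
   element of its subgroup, so that [C = D]. *)
have uniq v w : [/\ [set a; b] v, [set c; d] v & std (star e v) (g^-1 * h)%g] ->
    [/\ [set a; b] w, [set c; d] w & std (star e w) (g^-1 * h)%g] -> v = w.
  move=> [abv cdv vgh] [abw cdw wgh]; apply: contrapT => vw; apply: CD.
  have pairE i j : e i j -> [set i; j] v -> [set i; j] w -> e v w /\ [set i; j] = [set v; w].
    move=> ij ijv ijw; have [k vk E] := edge_other e_sym ij ijv.
    by move: ijw; rewrite E => -[/esym//|->].
  have [vw' abE] := pairE a b ab abv abw; have [_ cdE] := pairE c d cd cdv cdw.
  by rewrite /pair_coset abE cdE; apply: left_coset_eq; exact: std_star_pair.
have abx := (coset_conj_interP _ _).1 xS g a b ab SC.
have aby := (coset_conj_interP _ _).1 yS' g a b ab S'C.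
have conj1 z : z <> 1%g -> (g^-1 * z * g)%g <> 1%g.
  move=> z1 gz; apply: z1; apply: (mulgI g^-1%g); apply: (mulIg g).
  by rewrite gz mulg1 mulVg.
have [v vx] := pair_expo_neq0 e_sym e_irr ab abx (conj1 _ x1).
have [w wy] := pair_expo_neq0 e_sym e_irr ab aby (conj1 _ y1).
have vxP u : expo u x <> 0 -> _ := pair_coset_simplex ab cd SC SD xS.
have wyP u : expo u y <> 0 -> _ := pair_coset_simplex ab cd S'C S'D yS'.
rewrite !expo_conjV in vx wy.
have wv := uniq _ _ (wyP _ wy) (vxP _ vx); rewrite {w}wv in wy.
have [abv _ _] := vxP _ vx; have [p vp abE] := edge_other e_sym ab abv.
have vp' : v <> p by move=> v_p; move: vp; rewrite v_p e_irr.
(* A nonzero exponent in [p] would make [p] a second shared direction. *)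
have xE : (g^-1 * x * g)%g = zpow (gen v) (expo v x).
  rewrite abE in abx; rewrite (pair_decomp e_sym e_irr vp abx) !expo_conjV.
  have [->|/eqP px] := eqVneq (expo p x) 0; first by rewrite mulg1.
  by case: vp'; exact: uniq _ _ (vxP _ vx) (vxP _ px).
have yE : (g^-1 * y * g)%g = zpow (gen v) (expo v y).
  rewrite abE in aby; rewrite (pair_decomp e_sym e_irr vp aby) !expo_conjV.
  have [->|/eqP py] := eqVneq (expo p y) 0; first by rewrite mulg1.
  by case: vp'; exact: uniq _ _ (wyP _ wy) (wyP _ py).
have zE : zpow x (expo v y) = zpow y (expo v x).
  apply: (mulgI g^-1%g); apply: (mulIg g).
  by rewrite -!conj_zpow xE yE -!zpowM mulrC.
apply: (coset_simplexI (x := zpow x (expo v y)) (v := v)).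
- by rewrite finite_setU; split; [exact: simplex_finite KS|exact: simplex_finite KS'].
- by exists (pair_coset g a b); left.
- by move=> E [/SP|/S'P].
- apply/coset_conj_interP => k i j ij [Sk|S'k].
    by rewrite -conj_zpow; apply: std_zpow; exact: (coset_conj_interP _ _).1 xS k i j ij Sk.
  by rewrite zE -conj_zpow; apply: std_zpow; exact: (coset_conj_interP _ _).1 yS' k i j ij S'k.
- by rewrite expo_zpow //; apply/eqP; rewrite mulf_neq0 //; apply/eqP.
Qed.

Lemma coset_adjacentE g h a b c d : e a b -> e c d ->
  adjacent K (pair_coset g a b) (pair_coset h c d) ->
  exists v, [/\ [set a; b] v, [set c; d] v & std (star e v) (g^-1 * h)%g].
Proof.
move=> ab cd gh; have [x x1 xS] := coset_simplex_element gh.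
have abx := (coset_conj_interP _ _).1 xS g a b ab (or_introl erefl).
have gx1 : (g^-1 * x * g)%g <> 1%g.
  move=> gx; apply: x1; apply: (mulgI g^-1%g); apply: (mulIg g).
  by rewrite gx mulg1 mulVg.
have [v vx] := pair_expo_neq0 e_sym e_irr ab abx gx1; rewrite expo_conjV in vx.
by exists v; apply: pair_coset_simplex xS vx => //; [left|right].
Qed.

Lemma coset_vertexP C :
  simplex K [set C] <-> exists g a b, e a b /\ C = pair_coset g a b.
Proof.
split=> [[_ _ /(_ C erefl)/cosetsP//]|[g [a [b [ab ->]]]]].
apply: (@adjacent_vertex _ _ (pair_coset g a b)).
apply: (pair_coset_adjacent (x := (g * gen a * g^-1)%g) (v := a) ab ab);
  rewrite ?expo_conj ?expo_gen ?eqxx //; rewrite !mulgA mulVg mul1g mulgVK; apply: std_gen; by left.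
Qed.

Lemma expo_conj_gen g a : expo a (g * gen a * g^-1)%g <> 0.
Proof. by rewrite expo_conj // expo_gen // eqxx. Qed.

Lemma conjgK_gen g x : (g^-1 * (g * x * g^-1) * g)%g = x.
Proof. by rewrite !mulgA mulVg mul1g mulgVK. Qed.

(** * Comparison with the extension graph *)

(** As [pair_coset g a b] is symmetric in [a] and [b], a coset is related to the conjugates of both
    of its generators. *)
Definition coset_conjugate (C : set G) x : Prop :=
  exists g a b, [/\ e a b, C = pair_coset g a b & x = (g * gen a * g^-1)%g].

Lemma coset_conjugate_adjacent C C' x :
  coset_conjugate C x -> coset_conjugate C' x -> adjacent K C C'.
Proof.
move=> [g [a [b [ab -> xg]]]] [h [c [d [cd -> xh]]]].
apply: (pair_coset_adjacent ab cd (x := x) (v := a)).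
- by rewrite xg conjgK_gen; apply: std_gen; left.
- by rewrite xh conjgK_gen; apply: std_gen; left.
- by rewrite xg; exact: expo_conj_gen.
Qed.

Lemma conj_star g h v : std (star e v) (g^-1 * h)%g ->
  (g * gen v * g^-1 = h * gen v * h^-1)%g.
Proof.
move=> /star_commute vgh; apply: (mulIg h); rewrite mulgVK -!mulgA vgh.
by rewrite !mulgA mulgV mul1g.
Qed.

(** The middle vertex is the conjugate of the shared direction [v]; it is the same for [g] and [h]
    because [g^-1 * h] centralizes [v]. *)
Lemma coset_conjugate_extension C C' x x' : adjacent K C C' ->
  coset_conjugate C x -> coset_conjugate C' x' -> reach (extension_graph e) 2 x x'.
Proof.
move=> CC' [g [a [b [ab Cg xg]]]] [h [c [d [cd C'h xh]]]].
rewrite {}Cg {}C'h in CC'; have [v [abv cdv vgh]] := coset_adjacentE ab cd CC'.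
have commute_conj k u w i j : e i j -> [set i; j] u -> [set i; j] w ->
    commute (k * gen u * k^-1)%g (k * gen w * k^-1)%g.
  move=> ij iju ijw; have uw := pair_abelian ij (std_gen iju) (std_gen ijw).
  by rewrite /commute !mulgA !mulgVK -!(mulgA k) uw.
exists (g * gen v * g^-1)%g.
  apply: reach1; apply: graph_adjacent; rewrite ?xg; [by exists a, g|by exists v, g|].
  by apply: commute_conj ab _ abv; left.
apply: graph_adjacent; rewrite ?xh; [by exists v, g|by exists c, h|].
by rewrite (conj_star vgh); apply: commute_conj cd cdv _; left.
Qed.

(** Commuting vertices are conjugates of [a] and [c] by one element [h * k]; when [a] and [c] are
    adjacent, the coset of [h * k] for this edge is adjacent to both [C] and [C']. *)
Lemma extension_coset_conjugate C C' x x' : adjacent (extension_graph e) x x' ->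
  coset_conjugate C x -> coset_conjugate C' x' -> reach K 2 C C'.
Proof.
move=> xx' Cx C'x'; have {}xx' : commute x x'.
  by case: (graph_adjacentE _ xx') => [y z /commute_sym//|->|//]; exact: commute_refl.
have [g [a [b [ab _ xg]]]] := Cx; have [h [c [d [cd _ xh]]]] := C'x'.
have gxh : commute ((h^-1 * g) * gen a * (h^-1 * g)^-1)%g (gen c).
  have -> : ((h^-1 * g) * gen a * (h^-1 * g)^-1 = h^-1 * x * h)%g.
    by rewrite xg invgM invgK !mulgA.
  have -> : gen c = (h^-1 * x' * h)%g by rewrite xh conjgK_gen.
  by rewrite /commute !mulgA !mulgK -!(mulgA h^-1%g) xx'.
have [k [ck kE ca]] := commuting_conjugates e_sym e_irr gxh.
have xk : x = ((h * k) * gen a * (h * k)^-1)%g.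
  have -> : ((h * k) * gen a * (h * k)^-1 = h * (k * gen a * k^-1) * h^-1)%g.
    by rewrite invgM !mulgA.
  by rewrite -kE xg invgM invgK !mulgA mulgV mul1g mulgK.
have hk : (h * gen c * h^-1 = (h * k) * gen c * (h * k)^-1)%g.
  by apply: conj_star; rewrite mulKg.
case: ca => [ac|ca].
  (* Here [a = c], so [x = x'], and the second step stays at [C']. *)
  exists C'; last exact: coset_conjugate_adjacent (C'x') (C'x').
  apply: reach1; apply: (coset_conjugate_adjacent (x := x)) => //.
  by rewrite xk ac -hk -xh.
exists (pair_coset (h * k)%g a c).
  apply: reach1; apply: (coset_conjugate_adjacent Cx).
  by exists (h * k)%g, a, c; rewrite e_sym.
apply: (coset_conjugate_adjacent (x := x')) C'x'.
exists (h * k)%g, c, a; split => //; last by rewrite xh.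
by rewrite /pair_coset setUC.
Qed.

Lemma coset_conjugate_vertices C x : coset_conjugate C x ->
  simplex K [set C] /\ simplex (extension_graph e) [set x].
Proof.
move=> [g [a [b [ab -> ->]]]]; split; first by apply/coset_vertexP; exists g, a, b.
by apply/graph_vertexP; exists a, g.
Qed.

Lemma extension_quasi_isometric (R : realType) :
  complex_quasi_isometric R K (extension_graph e).
Proof.
apply: (@correspondence_quasi_isometric R _ _ _ _ coset_conjugate 2).
- exact: coset_complex_linear.
- exact: graph_linear.
- exact: coset_conjugate_vertices.
- by move=> C /coset_vertexP[g [a [b [ab CE]]]]; exists (g * gen a * g^-1)%g, g, a, b.
- move=> x /graph_vertexP[v [g ->]]; have [p vp] := e_nbr v.
  by exists (pair_coset g v p), g, v, p.
- by move=> C C' x x'; exact: coset_conjugate_extension.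
- by move=> C C' x x'; exact: extension_coset_conjugate.
Qed.

(** * Comparison with the contact graph *)

Lemma clique_set0 : clique e (finset.set0 : {set T}).
Proof. by apply/forall_inP => u; rewrite inE. Qed.

Lemma clique_set1 a : clique e [set a]%SET.
Proof.
apply/forall_inP => u /finset.set1P ->; apply/forall_inP => v /finset.set1P ->.
by rewrite eqxx.
Qed.

Lemma clique_set2 a b : e a b -> clique e [set a; b]%SET.
Proof.
move=> ab; apply/forall_inP => u /finset.set2P uE; apply/forall_inP => v /finset.set2P vE.
by case: uE => ->; case: vE => ->; rewrite ?eqxx ?ab 1?e_sym ?ab ?implybT.
Qed.

Lemma clique_sub (s s' : {set T}) : s \subset s' -> clique e s' -> clique e s.
Proof.
move=> /fintype.subsetP ss' /forall_inP cs'; apply/forall_inP => u us; apply/forall_inP => v vs.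
by have /forall_inP := cs' u (ss' u us); apply; exact: ss'.
Qed.

Lemma clique_commute (s : {set T}) u v : clique e s -> u \in s -> v \in s ->
  commute (gen u) (gen v).
Proof.
move=> /forall_inP cs us vs; have [->|uv] := eqVneq u v; first exact: commute_refl.
by have /forall_inP/(_ v vs)/implyP/(_ uv)/gen_commute := cs u us.
Qed.

Definition edge_midcube g a : midcube e :=
  Midcube (mcube := Cube g (clique_set1 a)) (finset.set11 a).

Definition midcube_class (m : midcube e) : set (midcube e) :=
  [set n | clos_refl_sym_trans _ (@midcube_facet T e) m n].

Definition edge_hyperplane g a := midcube_class (edge_midcube g a).

Lemma midcube_class_facet m n : midcube_facet m n -> midcube_class m = midcube_class n.
Proof.
move=> mn; apply/seteqP; split => k mk; apply: rst_trans mk.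
  by apply: rst_sym; exact: rst_step.
exact: rst_step.
Qed.

(** The two edges are opposite sides of the square at [g] with directions [a] and [c], and its
    midcube has both midpoints as facets. *)
Lemma edge_hyperplane_link1 g a c : e a c ->
  edge_hyperplane g a = edge_hyperplane (g * gen c)%g a.
Proof.
move=> ac; have aac : a \in [set a; c]%SET by rewrite finset.set21.
pose m := Midcube (mcube := Cube g (clique_set2 ac)) aac.
have a_c : a != c by apply/eqP => a_c; move: (ac); rewrite a_c e_irr.
have dirsE : [set a]%SET = ([set a; c] :\ c)%SET.
  apply/finset.setP => u; rewrite !inE.
  by have [->|_] := eqVneq u c; rewrite /= ?orbF // eq_sym (negPf a_c).
rewrite /edge_hyperplane (@midcube_class_facet _ m); last first.
  by split => //; exists c; split; [rewrite finset.set22|exact: dirsE|left].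
rewrite (@midcube_class_facet (edge_midcube (g * gen c)%g a) m) //.
by split => //; exists c; split; [rewrite finset.set22|exact: dirsE|right].
Qed.

Lemma edge_hyperplane_link g a s : std [set c | e a c] s ->
  edge_hyperplane g a = edge_hyperplane (g * s)%g a.
Proof.
move=> as_; elim/std_ind: as_ => [|{}s c ac _ IH]; first by rewrite mulg1.
rewrite !mulgA IH; split; first exact: edge_hyperplane_link1.
by rewrite [in RHS](edge_hyperplane_link1 _ ac) mulgVK.
Qed.

(** Directions other than that of the midcube are removed one at a time, by passing to the facet
    with the same initial corner. *)
Lemma midcube_classE m : midcube_class m = edge_hyperplane (corner (mcube m)) (mdir m).
Proof.
have [n] := ubnP #|dirs (mcube m)|; elim: n m => // n IH [[g s cs] a /= as_] sn.
have [sa|] := eqVneq s [set a]%SET.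
  move: cs as_ {sn}; rewrite sa => cs as_; congr midcube_class; rewrite /edge_midcube.
  by rewrite (Prop_irrelevance cs (clique_set1 a)) (Prop_irrelevance as_ (finset.set11 a)).
rewrite finset.eqEsubset finset.sub1set as_ andbT => /subsetPn[c cs' /finset.set1P/eqP ca].
have cs1 := clique_sub (finset.subsetDl s [set c]) cs.
have as1 : a \in (s :\ c)%SET by rewrite !inE eq_sym ca.
have := IH (Midcube (mcube := Cube g cs1) as1) => /= <-.
  by apply/esym/midcube_class_facet; split => //; exists c; split => //; left.
by rewrite -ltnS; apply: leq_trans sn; rewrite ltnS [X in (_ < X)%N](cardsD1 c) cs'.
Qed.

(** An invariant of the hyperplane: the label of its dual edges and the extension graph vertex that
    it determines. *)
Definition midcube_conjugate (m : midcube e) : T * G :=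
  (mdir m, corner (mcube m) * gen (mdir m) * (corner (mcube m))^-1)%g.

Lemma conj_commute g u v : commute (gen u) (gen v) ->
  (g * gen u * gen v * (g * gen u)^-1 = g * gen v * g^-1)%g.
Proof. by move=> uv; rewrite invgM -!mulgA; congr (_ * _)%g; rewrite !mulgA uv mulgK. Qed.

(** The corner moves at most by a generator of the cube, which commutes with [v]. A separate clique
    [s] is used because faces of a cube may lose the direction [v]. *)
Lemma facet_conjugate (c d : cube e) (s : {set T}) v : facet c d -> clique e s ->
  dirs d \subset s -> v \in s ->
  (corner c * gen v * (corner c)^-1 = corner d * gen v * (corner d)^-1)%g.
Proof.
move=> [u [ud _ [->//|->]]] cs /fintype.subsetP ds vs.
by apply: conj_commute; exact: clique_commute cs (ds _ ud) vs.
Qed.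

Lemma midcube_class_conjugate m n : midcube_class m n ->
  midcube_conjugate m = midcube_conjugate n.
Proof.
elim=> {m n} [m n [mn mdE]|//|m n _ -> //|m n k _ -> _ -> //].
rewrite /midcube_conjugate mdE; congr pair.
exact: facet_conjugate mn (dirs_clique _) (subxx _) (mdir_in n).
Qed.

Lemma closed_cube_conjugate (c d : cube e) (s : {set T}) v : closed_cube d c ->
  clique e s -> dirs d \subset s -> v \in s ->
  (corner c * gen v * (corner c)^-1 = corner d * gen v * (corner d)^-1)%g.
Proof.
move=> dc cs ds vs; suff [] : (corner c * gen v * (corner c)^-1 =
    corner d * gen v * (corner d)^-1)%g /\ dirs c \subset s by [].
elim: dc ds => {c d} [c d cd ds|//|c d k _ IH1 _ IH2 ds].
  split; first exact: facet_conjugate cd cs ds vs.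
  by case: cd => u [_ -> _]; exact: fintype.subset_trans (finset.subsetDl _ _) ds.
have [<- /IH1] := IH2 ds; by [].
Qed.

Lemma carrier_conjugate g a (c : cube e) : carrier (edge_hyperplane g a) c ->
  (corner c * gen a * (corner c)^-1 = g * gen a * g^-1)%g.
Proof.
move=> [m /midcube_class_conjugate [-> ->] mc].
exact: closed_cube_conjugate mc (dirs_clique _) (subxx _) (mdir_in m).
Qed.

Lemma edge_hyperplane_adjacent g a b :
  adjacent (contact_graph e) (edge_hyperplane g a) (edge_hyperplane g b).
Proof.
apply: graph_adjacent; [by exists (edge_midcube g a)|by exists (edge_midcube g b)|].
have vertex c : carrier (edge_hyperplane g c) (Cube g clique_set0).
  exists (edge_midcube g c); first exact: rst_refl.
  by apply: rt_step; exists c; split; rewrite /= ?finset.set11 ?finset.setDv //; left.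
by exists (Cube g clique_set0); split; exact: vertex.
Qed.

(** The representative [g] is arbitrary, so a coset is related to all hyperplanes dual to edges of
    its flat. *)
Definition coset_hyperplane (C : set G) (H : set (midcube e)) : Prop :=
  exists g a b, [/\ e a b, C = pair_coset g a b & H = edge_hyperplane g a].

Lemma edge_hyperplane_zpow g u w n : e u w ->
  edge_hyperplane (g * zpow (gen u) n)%g w = edge_hyperplane g w.
Proof.
move=> uw; apply/esym/edge_hyperplane_link; apply: std_zpow.
by apply: std_gen; rewrite /= e_sym.
Qed.

(** Moving along [v] does not change the hyperplane dual to the other direction of the flat, and
    this one touches every hyperplane dual to [v] along the way. *)
Lemma flat_hyperplanes g a b v n : e a b -> [set a; b] v ->
  reach (contact_graph e) 2 (edge_hyperplane g a) (edge_hyperplane (g * zpow (gen v) n)%g v).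
Proof.
move=> ab [] ->.
  exists (edge_hyperplane g b); first exact/reach1/edge_hyperplane_adjacent.
  by rewrite -(edge_hyperplane_zpow g n ab); exact: edge_hyperplane_adjacent.
exists (edge_hyperplane g a); first exact/reach1/edge_hyperplane_adjacent.
rewrite -(@edge_hyperplane_zpow g b a n) 1?e_sym //; exact: edge_hyperplane_adjacent.
Qed.

(** Write [g^-1 * h] as a power of the shared direction [v] times an element of its link. The link
    factor fixes the hyperplane dual to [v], and the power is a move inside the flat of [C]. *)
Lemma coset_hyperplane_contact C C' H H' : adjacent K C C' ->
  coset_hyperplane C H -> coset_hyperplane C' H' -> reach (contact_graph e) 3 H H'.
Proof.
move=> CC' [g [a [b [ab Cg ->]]]] [h [c [d [cd C'h ->]]]].
rewrite {}Cg {}C'h in CC'; have [v [abv cdv vgh]] := coset_adjacentE ab cd CC'.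
have nv : ~ [set c | e v c] v by rewrite /= e_irr.
have starE : star e v = v |` [set c | e v c] by [].
rewrite starE in vgh; have ghE := std_decomp e_sym e_irr nv (fun _ => id) vgh.
exists (edge_hyperplane h v); last exact: edge_hyperplane_adjacent.
rewrite -(mulVKg g h) ghE mulgA -edge_hyperplane_link; last exact: retract_std.
exact: (flat_hyperplanes g _ ab abv).
Qed.

(** The corner of a cube common to both carriers serves as [k], by [carrier_conjugate]. *)
Lemma contact_conjugates g h a b :
  adjacent (contact_graph e) (edge_hyperplane g a) (edge_hyperplane h b) ->
  exists k, (k * gen a * k^-1 = g * gen a * g^-1)%g /\ (k * gen b * k^-1 = h * gen b * h^-1)%g.
Proof.
move=> /graph_adjacentE[H H' [c [Hc H'c]]|gh|[c [/carrier_conjugate gc /carrier_conjugate hc]]].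
- by exists c.
- exists g; have : edge_hyperplane g a (edge_midcube h b) by rewrite gh; exact: rst_refl.
  by move=> /midcube_class_conjugate[<- ->].
- by exists (corner c).
Qed.

(** With [k] fixed, the cosets of two edges with a common vertex are adjacent, so a path in the
    defining graph gives a path of cosets. *)
Lemma path_pair_coset k a c s d : e a c -> path e a s -> e (last a s) d ->
  reach K (size s).+1 (pair_coset k a c) (pair_coset k (last a s) d).
Proof.
have gen_adjacent u v w : e u v -> e u w -> adjacent K (pair_coset k u v) (pair_coset k u w).
  move=> uv uw; apply: (coset_conjugate_adjacent (x := (k * gen u * k^-1)%g)).
    by exists k, u, v.
  by exists k, u, w.
elim: s a c => [|b s IH] a c ac; first by move=> _ ad; exact/reach1/gen_adjacent.
move=> /andP[ab bs] bd; rewrite -[X in reach K X]add1n.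
apply: reach_cat (IH _ a _ bs bd); last by rewrite e_sym.
by apply: reach1; rewrite [X in adjacent _ _ X]/pair_coset setUC; exact: gen_adjacent.
Qed.

Hypothesis e_conn : forall u v, connect e u v.

(** One step leads from [C] to the coset of [k] for [a] and [b], a path from [a] to [c] in the
    defining graph to that for [c] and [d], and one more step to [C']. *)
Lemma contact_coset_hyperplane C C' H H' : adjacent (contact_graph e) H H' ->
  coset_hyperplane C H -> coset_hyperplane C' H' -> reach K (#|T| + 2) C C'.
Proof.
move=> HH' [g [a [b [ab Cg Hg]]]] [h [c [d [cd C'h H'h]]]].
rewrite Hg H'h in HH'; have [k [ka kc]] := contact_conjugates HH'.
(* The path is made simple, so its number of vertices is at most [#|T|], uniformly in the
   hyperplanes. *)
have /connectP[s0 as0 cE] := e_conn a c; case: (shortenP as0) cE => s as_ us _ cE.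
have sT : ((size s).+1 <= #|T|)%N by have := max_card (mem (a :: s)); rewrite (card_uniqP us).
have C'vertex : simplex K [set C'] by apply/coset_vertexP; exists h, c, d.
apply: (reach_widen (m := 1 + (size s).+1 + 1)) => //; first by lia.
apply: (@reach_cat _ _ _ _ _ (pair_coset k c d)).
  apply: (@reach_cat _ _ _ _ _ (pair_coset k a b)); last first.
    by rewrite cE; apply: path_pair_coset => //; rewrite -cE.
  apply/reach1/(coset_conjugate_adjacent (x := (g * gen a * g^-1)%g)); first by exists g, a, b.
  by exists k, a, b.
apply/reach1/(coset_conjugate_adjacent (x := (h * gen c * h^-1)%g)); first by exists k, c, d.
by exists h, c, d.
Qed.

Lemma coset_hyperplane_vertices C H : coset_hyperplane C H ->
  simplex K [set C] /\ simplex (contact_graph e) [set H].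
Proof.
move=> [g [a [b [ab -> ->]]]]; split; first by apply/coset_vertexP; exists g, a, b.
by apply/graph_vertexP; exists (edge_midcube g a).
Qed.

Lemma contact_quasi_isometric (R : realType) :
  complex_quasi_isometric R K (contact_graph e).
Proof.
(* The constant dominates both [3] and [#|T| + 2], the bounds in the two directions. *)
apply: (@correspondence_quasi_isometric R _ _ _ _ coset_hyperplane (#|T| + 3)).
- exact: coset_complex_linear.
- exact: graph_linear.
- exact: coset_hyperplane_vertices.
- by move=> C /coset_vertexP[g [a [b [ab CE]]]]; exists (edge_hyperplane g a), g, a, b.
- move=> H /graph_vertexP[m ->]; have [p mp] := e_nbr (mdir m).
  exists (pair_coset (corner (mcube m)) (mdir m) p), (corner (mcube m)), (mdir m), p.
  by split => //; exact: midcube_classE.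
- move=> C C' H H' CC' CH C'H'; apply: reach_widen (coset_hyperplane_contact CC' CH C'H').
    exact: (coset_hyperplane_vertices C'H').2.
  by rewrite leq_addl.
- move=> C C' H H' HH' CH C'H'; apply: reach_widen (contact_coset_hyperplane HH' CH C'H').
    exact: (coset_hyperplane_vertices C'H').1.
  by rewrite leq_add2l.
Qed.

End CosetComplex.

Theorem theorem1p2 (R : realType) (T : finType) (e : rel T)
  (e_sym : symmetric e) (e_irr : irreflexive e)
  (e_conn : connected_graph e) (e_tri : triangle_free e)
  (e_val : forall v : T, (2 <= valence e v)%N) :
  complex_quasi_isometric R
    (coset_intersection_complex (max_standard_abelian e))
    (extension_graph e) /\
  complex_quasi_isometric R
    (coset_intersection_complex (max_standard_abelian e))
    (contact_graph e).
Proof.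
have e_nbr v : exists p, e v p.
  have /card_gt0P[p vp] : (0 < #|[pred u | e v u]|)%N by apply: leq_trans (e_val v).
  by exists p.
have [/card_gt0P[v _] e_con] := e_conn; have T_neq0 := inhabits v.
split; first exact: extension_quasi_isometric.
exact: contact_quasi_isometric.
Qed.
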